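(* For an ordinal $\alpha$ and a nonzero natural number $k$, let $G_{\alpha,k}=\mathrm{Homeo}([0,\omega^\alpha\cdot k])$. If $G_{\alpha,k}$ and $G_{\alpha',k'}$ are isomorphic as topological groups, then $\alpha=\alpha'$ and $k=k'$. In particular, if two compact ordinal spaces have homeomorphism groups isomorphic as topological groups, then the two spaces are homeomorphic.
   Context: An ordinal space is an ordinal with its order topology; $[0,\gamma]=\gamma+1$ denotes the ordinal space of ordinals $\le\gamma$. The compact ordinal spaces are $0$ and the successor ordinals. Homeomorphism groups of ordinal spaces carry the topology of pointwise convergence.
   Formalization: In the last sentence the compact ordinal spaces are taken nonempty: the empty space 0 is excluded, since its homeomorphism group and that of the one-point space are both trivial although the two spaces are not homeomorphic. *)

(* Defs.v *)
From Stdlib Require Import List Arith PeanoNat.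

Record WOrd := {
  wcar :> Type;
  wlt : wcar -> wcar -> Prop;
  wlt_irrefl : forall x, ~ wlt x x;
  wlt_trans : forall x y z, wlt x y -> wlt y z -> wlt x z;
  wlt_total : forall x y, wlt x y \/ x = y \/ wlt y x;
  wlt_wf : well_founded wlt }.

(* Equality of ordinals = existence of an order isomorphism. *)
Definition ord_iso (A B : WOrd) : Prop :=
  exists (f : wcar A -> wcar B) (g : wcar B -> wcar A),
    (forall x, g (f x) = x) /\ (forall y, f (g y) = y) /\
    (forall x y, wlt A x y <-> wlt B (f x) (f y)).

(* omega^alpha: finitely supported functions alpha -> nat, compared at the
   largest point of difference (Cantor normal form). *)
Definition fsupp {A : Type} (f : A -> nat) : Prop :=
  exists l : list A, forall a, f a <> 0 -> In a l.

Definition OmPow (A : WOrd) : Type := { f : wcar A -> nat | fsupp f }.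

Definition om_lt (A : WOrd) (f g : OmPow A) : Prop :=
  exists a, proj1_sig f a < proj1_sig g a /\
    forall b, wlt A a b -> proj1_sig f b = proj1_sig g b.

(* omega^alpha * k : k copies of omega^alpha, the copy index being most
   significant. *)
Definition Fin (k : nat) : Type := { i : nat | i < k }.

Definition OmK (A : WOrd) (k : nat) : Type := (OmPow A * Fin k)%type.

Definition omk_lt (A : WOrd) (k : nat) (p q : OmK A k) : Prop :=
  proj1_sig (snd p) < proj1_sig (snd q) \/
  (snd p = snd q /\ om_lt A (fst p) (fst q)).

(* [0, gamma] = gamma + 1 : adjoin a top element (None). *)
Definition succ_lt {T : Type} (lt : T -> T -> Prop) (x y : option T) : Prop :=
  match x, y with
  | Some a, Some b => lt a b
  | Some _, None => True
  | None, _ => False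
  end.

Definition lower_ok {T : Type} (lt : T -> T -> Prop) (a : option T) (y : T) :=
  match a with None => True | Some a => lt a y end.
Definition upper_ok {T : Type} (lt : T -> T -> Prop) (b : option T) (y : T) :=
  match b with None => True | Some b => lt y b end.

Definition order_open {T : Type} (lt : T -> T -> Prop) (U : T -> Prop) : Prop :=
  forall x, U x -> exists a b : option T,
    lower_ok lt a x /\ upper_ok lt b x /\
    forall y, lower_ok lt a y -> upper_ok lt b y -> U y.

Definition cont {T T' : Type} (lt : T -> T -> Prop) (lt' : T' -> T' -> Prop)
  (f : T -> T') : Prop :=
  forall U, order_open lt' U -> order_open lt (fun x => U (f x)).

Definition homeomorphic {T T' : Type} (lt : T -> T -> Prop)
  (lt' : T' -> T' -> Prop) : Prop :=
  exists (f : T -> T') (g : T' -> T),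
    (forall x, g (f x) = x) /\ (forall y, f (g y) = y) /\
    cont lt lt' f /\ cont lt' lt g.

Definition is_homeo {T : Type} (lt : T -> T -> Prop) (f : T -> T) : Prop :=
  exists g : T -> T,
    (forall x, g (f x) = x) /\ (forall x, f (g x) = x) /\
    cont lt lt f /\ cont lt lt g.

(* Open subsets of Homeo(T) for the topology of pointwise convergence:
   generated by the subbasic sets { g | g x \in U }, U open. *)
Definition ptws_open {T : Type} (lt : T -> T -> Prop) (S : (T -> T) -> Prop)
  : Prop :=
  forall f, is_homeo lt f -> S f ->
    exists l : list (T * (T -> Prop)),
      (forall p, In p l -> order_open lt (snd p) /\ snd p (f (fst p))) /\
      (forall g, is_homeo lt g ->
         (forall p, In p l -> snd p (g (fst p))) -> S g).

Definition ptws_cont {T T' : Type} (lt : T -> T -> Prop)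
  (lt' : T' -> T' -> Prop) (F : (T -> T) -> (T' -> T')) : Prop :=
  forall S, ptws_open lt' S -> ptws_open lt (fun f => S (F f)).

Definition top_grp_iso {T T' : Type} (lt : T -> T -> Prop)
  (lt' : T' -> T' -> Prop) : Prop :=
  exists (F : (T -> T) -> (T' -> T')) (G : (T' -> T') -> (T -> T)),
    (forall f, is_homeo lt f -> is_homeo lt' (F f)) /\
    (forall g, is_homeo lt' g -> is_homeo lt (G g)) /\
    (forall f, is_homeo lt f -> G (F f) = f) /\
    (forall g, is_homeo lt' g -> F (G g) = g) /\
    (forall f1 f2, is_homeo lt f1 -> is_homeo lt f2 ->
       F (fun x => f1 (f2 x)) = (fun y => F f1 (F f2 y))) /\
    ptws_cont lt lt' F /\ ptws_cont lt' lt G.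

Definition SpAK (A : WOrd) (k : nat) : Type := option (OmK A k).
Definition spak_lt (A : WOrd) (k : nat) : SpAK A k -> SpAK A k -> Prop :=
  succ_lt (omk_lt A k).

(* Main.v *)
(* Let X be a compact ordinal space. Its isolated points form a dense set I, so
   Homeo(X) acts faithfully on I. If I is infinite, the transpositions of isolated
   points are exactly the involutions t <> 1 with (t g t g^-1)^6 = 1 for all g;
   hence an isomorphism F of homeomorphism groups is induced by a bijection
   phi : I -> I'. A subset C of I is NOT the trace of a clopen set iff there are
   points c_n in C, pairwise distinct, and d_n in I \ C such that for every set M
   of indices some homeomorphism sends c_n to d_n for n in M and fixes c_n for n
   not in M: if C is not such a trace, two sequences from C and I \ C have the same
   supremum and may be swapped pairwise; conversely, along an increasing
   subsequence of (c_n), such a homeomorphism would fix the supremum while moving it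
   to the closure of I \ C. So phi respects traces of clopen sets and extends to a
   homeomorphism of X with X'. If X is finite, the
   order (n+1)! of the symmetric group on n+1 points is compared with n!.

   Homeomorphic spaces [0, omega^alpha * k] have the same alpha and k since alpha
   is the largest Cantor-Bendixson rank and k is the number of points of that
   rank (one more if alpha = 0). *)

From mathcomp Require all_boot all_fingroup.
Require Import Defs.
From Stdlib Require Import List Arith PeanoNat.
From Stdlib Require Import Lia Classical ClassicalEpsilon FunctionalExtensionality.

(** * Topology of a well-order *)

Notation "x << y" := (wlt _ x y) (at level 70).
Definition wle {W : WOrd} (x y : W) : Prop := x = y \/ x << y.
Notation "x <<= y" := (wle x y) (at level 70).

(** [wo] settles small goals about a linear order: split each [<<=] into its two cases, close the
    strict relations under transitivity, then look for a conflict with irreflexivity. For an order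
    goal it first splits on totality. *)
Ltac wo_cases := unfold wle in *; repeat match goal with
  | H : _ /\ _ |- _ => destruct H
  | H : ?x = ?y \/ wlt _ ?x ?y |- _ => destruct H; subst
  end;
  repeat match goal with H : @eq (wcar _) _ _ |- _ => rewrite H in *; clear H end.
Ltac wo_sat := repeat match goal with
  | H1 : wlt ?W ?x ?y, H2 : wlt ?W ?y ?z |- _ =>
    lazymatch goal with
    | _ : wlt W x z |- _ => fail
    | _ => pose proof (wlt_trans W x y z H1 H2)
    end
  end.
Ltac wo_close := wo_sat; solve [assumption | tauto | congruence
  | exfalso; match goal with H : wlt _ ?x ?x |- _ => exact (wlt_irrefl _ _ H) end ].
Ltac wo := intros; match goal with
  | |- @wle ?W ?x ?y =>
     destruct (wlt_total W x y) as [|[|]]; wo_cases; wo_close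
  | |- wlt ?W ?x ?y =>
     destruct (wlt_total W x y) as [|[|]]; wo_cases; wo_close
  | |- _ => wo_cases; wo_close
  end.

Lemma functional_choice {A B : Type} (R : A -> B -> Prop) :
  (forall x, exists y, R x y) -> exists f, forall x, R x (f x).
Proof.
  intros H; exists (fun x => proj1_sig (constructive_indefinite_description _ (H x))).
  intros x; apply proj2_sig.
Qed.

Lemma wle_or_lt (W : WOrd) (x y : W) : x <<= y \/ y << x.
Proof. unfold wle; destruct (wlt_total W x y) as [|[|]]; auto. Qed.

Lemma wlt_neq (W : WOrd) (x y : W) : x << y -> x <> y.
Proof. intros H ->; exact (wlt_irrefl _ _ H). Qed.

Lemma wmin (W : WOrd) (P : W -> Prop) :
  (exists x, P x) -> exists x, P x /\ forall y, P y -> x <<= y.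
Proof.
  intros [x Hx]; induction (wlt_wf W x) as [x _ IH].
  destruct (classic (exists y, P y /\ y << x)) as [[y [Hy Hyx]]|N]; [eauto|].
  exists x; split; auto; intros y Hy.
  destruct (wle_or_lt W x y); auto; exfalso; eauto.
Qed.

Definition above {W : WOrd} (a : option W) (y : W) : Prop := lower_ok (wlt W) a y.

Lemma above_le (W : WOrd) (a : option W) (x y : W) : above a x -> x <<= y -> above a y.
Proof. destruct a; simpl; auto; wo. Qed.

(* In a well-order the sets (a, x] are open, so neighbourhoods may be tested
   from below only. *)
Definition nhd {W : WOrd} (x : W) (U : W -> Prop) : Prop :=
  exists a, above a x /\ forall y, above a y -> y <<= x -> U y.

Lemma nhd_self (W : WOrd) (x : W) U : nhd x U -> U x.
Proof. intros [a [H K]]; apply K; auto; left; auto. Qed.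

Lemma nhd_mono (W : WOrd) (x : W) (U V : W -> Prop) :
  nhd x U -> (forall y, U y -> V y) -> nhd x V.
Proof. intros [a [H K]] S; exists a; split; auto. Qed.

Lemma nhd_and (W : WOrd) (x : W) (U V : W -> Prop) :
  nhd x U -> nhd x V -> nhd x (fun y => U y /\ V y).
Proof.
  intros [[a|] [H K]] [[b|] [H' K']].
  - destruct (wle_or_lt W a b).
    + exists (Some b); split; auto; intros y Hy Hx; split; auto.
      apply K; auto; simpl in *; wo.
    + exists (Some a); split; auto; intros y Hy Hx; split; auto.
      apply K'; auto; simpl in *; wo.
  - exists (Some a); split; auto; intros; split; auto; apply K'; simpl; auto.
  - exists (Some b); split; auto; intros; split; auto; apply K; simpl; auto.
  - exists None; split; simpl in *; auto.
Qed.

Lemma nhd_le (W : WOrd) (x z : W) : x <<= z -> nhd x (fun y => y <<= z).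
Proof. intros H; exists None; split; simpl; auto; wo. Qed.

Lemma nhd_gt (W : WOrd) (x z : W) : z << x -> nhd x (fun y => z << y).
Proof. intros H; exists (Some z); split; simpl; auto; wo. Qed.

Lemma nhd_hausdorff (W : WOrd) (x y : W) : x <> y ->
  exists U V, nhd x U /\ nhd y V /\ forall z, U z -> V z -> False.
Proof.
  intros N; destruct (wlt_total W x y) as [H|[H|H]]; [|contradiction|].
  - exists (fun z => z <<= x), (fun z => x << z); repeat split.
    + apply nhd_le; left; auto.
    + apply nhd_gt; auto.
    + wo.
  - exists (fun z => y << z), (fun z => z <<= y); repeat split.
    + apply nhd_gt; auto.
    + apply nhd_le; left; auto.
    + wo.
Qed.

Lemma open_nhd (W : WOrd) (U : W -> Prop) :
  order_open (wlt W) U <-> forall x, U x -> nhd x U.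
Proof.
  split.
  - intros H x Hx; destruct (H x Hx) as [a [b [Ha [Hb K]]]].
    exists a; split; auto; intros y Hy Hyx; apply K; auto.
    destruct b; simpl in *; auto; wo.
  - intros H x Hx; destruct (H x Hx) as [a [Ha K]].
    destruct (classic (exists s, x << s)) as [E|N].
    + destruct (wmin W _ E) as [s [Hs Hmin]].
      exists a, (Some s); split; auto; split; auto.
      intros y Hy Hys; apply K; auto.
      destruct (wle_or_lt W y x) as [|L]; auto.
      specialize (Hmin y L); simpl in *; wo.
    + exists a, None; split; auto; split; simpl; auto.
      intros y Hy _; apply K; auto.
      destruct (wle_or_lt W y x) as [|L]; auto; exfalso; eauto.
Qed.

Lemma open_interval (W : WOrd) (a : option W) (x : W) :
  order_open (wlt W) (fun y => above a y /\ y <<= x).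
Proof.
  apply open_nhd; intros y [Ha Hx]; exists a; split; auto.
  intros z Hz Hzy; split; auto; wo.
Qed.

Lemma cont_nhd (W W' : WOrd) (f : W -> W') :
  cont (wlt W) (wlt W') f <->
  forall x U, nhd (f x) U -> nhd x (fun y => U (f y)).
Proof.
  split.
  - intros C x U [a [Ha K]].
    pose proof (C _ (open_interval W' a (f x))) as O.
    rewrite open_nhd in O.
    assert (N : nhd x (fun y => above a (f y) /\ f y <<= f x)).
    { apply O; split; auto; left; auto. }
    eapply nhd_mono; [exact N|]; simpl; intros y [? ?]; auto.
  - intros H U OU; apply open_nhd; intros x Hx.
    rewrite open_nhd in OU; auto.
Qed.

Definition isol {W : WOrd} (x : W) : Prop := nhd x (fun y => y = x).

(** The least element of (a, x] is isolated, since the interval from [a] up to it is a singleton. *)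
Lemma isol_dense (W : WOrd) (x : W) U : nhd x U -> exists i, isol i /\ U i.
Proof.
  intros [a [Ha K]].
  destruct (wmin W (fun y => above a y /\ y <<= x)) as [i [[Hi Hix] Hmin]].
  { exists x; split; auto; left; auto. }
  exists i; split; auto.
  exists a; split; auto; intros y Hy Hyi.
  assert (i <<= y) by (apply Hmin; split; auto; wo); wo.
Qed.

(** Isolated points are dense and the target is Hausdorff; hence a homeomorphism is determined by
    its action on isolated points. *)
Lemma cont_eq_isol (W W' : WOrd) (f g : W -> W') :
  cont (wlt W) (wlt W') f -> cont (wlt W) (wlt W') g ->
  (forall i, isol i -> f i = g i) -> f = g.
Proof.
  intros Cf Cg E; apply functional_extensionality; intros x.
  apply NNPP; intros N.
  destruct (nhd_hausdorff _ _ _ N) as [U [V [HU [HV D]]]].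
  rewrite cont_nhd in Cf, Cg.
  destruct (isol_dense _ _ _ (nhd_and _ _ _ _ (Cf x U HU) (Cg x V HV)))
    as [i [Hi [H1 H2]]].
  rewrite (E i Hi) in H1; eauto.
Qed.

Lemma isol_homeo (W W' : WOrd) (f : W -> W') (g : W' -> W) (x : W) :
  (forall x, g (f x) = x) -> (forall y, f (g y) = y) ->
  cont (wlt W') (wlt W) g -> isol x -> isol (f x).
Proof.
  intros gf fg C Hx; rewrite cont_nhd in C.
  unfold isol in *; rewrite <- (gf x) in Hx at 1.
  eapply nhd_mono; [exact (C _ _ Hx)|]; simpl; intros y <-; auto.
Qed.

Lemma isol_is_homeo (W : WOrd) (f : W -> W) (x : W) :
  is_homeo (wlt W) f -> isol x -> isol (f x).
Proof. intros [g [gf [fg [Cf Cg]]]]; eapply isol_homeo; eauto. Qed.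

(** * The group of homeomorphisms *)

Lemma cont_id (W : WOrd) : cont (wlt W) (wlt W) (fun x => x).
Proof. intros U H; exact H. Qed.

Lemma cont_comp (W1 W2 W3 : WOrd) (f : W2 -> W3) (g : W1 -> W2) :
  cont (wlt W2) (wlt W3) f -> cont (wlt W1) (wlt W2) g ->
  cont (wlt W1) (wlt W3) (fun x => f (g x)).
Proof. intros Hf Hg U OU; exact (Hg _ (Hf _ OU)). Qed.

Lemma homeo_id (W : WOrd) : is_homeo (wlt W) (fun x => x).
Proof. exists (fun x => x); repeat split; auto; apply cont_id. Qed.

Lemma homeo_comp (W : WOrd) (f g : W -> W) :
  is_homeo (wlt W) f -> is_homeo (wlt W) g ->
  is_homeo (wlt W) (fun x => f (g x)).
Proof.
  intros [f' [a [b [c d]]]] [g' [a' [b' [c' d']]]].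
  exists (fun x => g' (f' x)); repeat split.
  - intros x; rewrite a; auto.
  - intros x; rewrite b'; auto.
  - apply cont_comp; auto.
  - apply cont_comp; auto.
Qed.

Lemma homeo_inv (W : WOrd) (f : W -> W) : is_homeo (wlt W) f ->
  exists g, is_homeo (wlt W) g /\
    (forall x, g (f x) = x) /\ (forall x, f (g x) = x).
Proof.
  intros [g [a [b [c d]]]]; exists g; repeat split; auto.
  exists f; repeat split; auto.
Qed.

Lemma homeo_inj (W : WOrd) (f : W -> W) (x y : W) :
  is_homeo (wlt W) f -> f x = f y -> x = y.
Proof. intros [g [a _]] E; rewrite <- (a x), <- (a y), E; auto. Qed.

Lemma homeo_cont (W : WOrd) (f : W -> W) :
  is_homeo (wlt W) f -> cont (wlt W) (wlt W) f.
Proof. intros [g [a [b [c d]]]]; exact c. Qed.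

Lemma nhd_neq (W : WOrd) (x z : W) : x <> z -> nhd x (fun y => y <> z).
Proof.
  intros N; destruct (nhd_hausdorff _ _ _ N) as [U [V [HU [HV D]]]].
  eapply nhd_mono; [exact HU|]; intros y Hy ->; exact (D _ Hy (nhd_self _ _ _ HV)).
Qed.

Lemma nhd_notin (W : WOrd) (l : list W) (x : W) :
  ~ In x l -> nhd x (fun y => ~ In y l).
Proof.
  induction l as [|z l IH]; simpl; intros N.
  - exists None; split; simpl; auto.
  - eapply nhd_mono.
    + apply nhd_and; [apply (nhd_neq W x z)|apply IH]; intuition.
    + simpl; intros y [? ?] [?|?]; auto.
Qed.

Lemma isol_notin (W : WOrd) (l : list W) :
  (exists x, ~ In x l) -> exists i, isol i /\ ~ In i l.
Proof. intros [x Hx]; exact (isol_dense W x _ (nhd_notin W l x Hx)). Qed.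

(** * Transpositions of isolated points *)

Definition tr {T : Type} (a b w : T) : T :=
  if excluded_middle_informative (w = a) then b
  else if excluded_middle_informative (w = b) then a else w.

Lemma tr_l {T} (a b : T) : tr a b a = b.
Proof. unfold tr; destruct excluded_middle_informative; congruence. Qed.

Lemma tr_r {T} (a b : T) : tr a b b = a.
Proof. unfold tr; repeat destruct excluded_middle_informative; congruence. Qed.

Lemma tr_o {T} (a b w : T) : w <> a -> w <> b -> tr a b w = w.
Proof. unfold tr; repeat destruct excluded_middle_informative; congruence. Qed.

Ltac tr_simp := repeat first
  [ rewrite tr_l | rewrite tr_r
  | match goal with |- context [tr ?a ?b ?w] => rewrite (tr_o a b w) by congruence end ].

Lemma tr_sym {T} (a b : T) : tr a b = tr b a.
Proof.
  apply functional_extensionality; intros w.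
  destruct (classic (w = a)) as [->|]; [tr_simp; auto|].
  destruct (classic (w = b)) as [->|]; tr_simp; auto.
Qed.

Lemma tr_tr {T} (a b w : T) : tr a b (tr a b w) = w.
Proof.
  destruct (classic (w = a)) as [->|]; [tr_simp; auto|].
  destruct (classic (w = b)) as [->|]; tr_simp; auto.
Qed.

Lemma tr_moves {T} (a b w : T) : tr a b w <> w -> w = a \/ w = b.
Proof. intros H; apply NNPP; intros N; apply H, tr_o; tauto. Qed.

Lemma tr_conj {T} (g g' : T -> T) (a b x : T) :
  (forall x, g' (g x) = x) -> (forall x, g (g' x) = x) ->
  g (tr a b (g' x)) = tr (g a) (g b) x.
Proof.
  intros H H'; destruct (classic (x = g a)) as [->|Na].
  { rewrite H; tr_simp; auto. }
  destruct (classic (x = g b)) as [->|Nb].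
  { rewrite H; tr_simp; auto. }
  assert (g' x <> a) by (intros E; apply Na; rewrite <- E; auto).
  assert (g' x <> b) by (intros E; apply Nb; rewrite <- E; auto).
  tr_simp; auto.
Qed.

(* The product of two transpositions has order 1, 2 or 3. *)
Lemma tr_order {T} (a b c d x : T) : a <> b -> c <> d ->
  Nat.iter 6 (fun x => tr a b (tr c d x)) x = x.
Proof.
  intros Hab Hcd; unfold Nat.iter, nat_rect.
  destruct (classic (a = c)) as [->|]; destruct (classic (b = d)) as [->|];
  [ | destruct (classic (b = c)) as [->|] | destruct (classic (a = d)) as [->|]
  | destruct (classic (a = d)) as [->|]; destruct (classic (b = c)) as [->|]];
  try congruence;
  (destruct (classic (x = c)) as [->|]; [tr_simp; congruence|]);
  (destruct (classic (x = d)) as [->|]; [tr_simp; congruence|]);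
  try (destruct (classic (x = a)) as [->|]; [tr_simp; congruence|]);
  try (destruct (classic (x = b)) as [->|]; [tr_simp; congruence|]);
  tr_simp; congruence.
Qed.

Lemma tr_homeo (W : WOrd) (a b : W) : isol a -> isol b -> is_homeo (wlt W) (tr a b).
Proof.
  intros Ha Hb.
  assert (C : cont (wlt W) (wlt W) (tr a b)).
  { apply cont_nhd; intros x U HU.
    destruct (classic (x = a)) as [->|Na].
    { eapply nhd_mono; [exact Ha|]; simpl; intros y ->; exact (nhd_self _ _ _ HU). }
    destruct (classic (x = b)) as [->|Nb].
    { eapply nhd_mono; [exact Hb|]; simpl; intros y ->; exact (nhd_self _ _ _ HU). }
    rewrite tr_o in HU by auto.
    eapply nhd_mono.
    - exact (nhd_and _ _ _ _ HU (nhd_and _ _ _ _ (nhd_neq _ x a Na) (nhd_neq _ x b Nb))).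
    - simpl; intros y [? [? ?]]; rewrite tr_o; auto. }
  exists (tr a b); repeat split; auto; intros; apply tr_tr.
Qed.

(** Only products, inverses and the identity of the group occur, so isomorphisms preserve this
    property. The exponent 6 is the least common multiple of 1, 2 and 3, the possible orders of a
    product of two transpositions. *)
Definition transp_like {W : WOrd} (t : W -> W) : Prop :=
  is_homeo (wlt W) t /\ (exists x, t x <> x) /\ (forall x, t (t x) = x) /\
  forall g g', is_homeo (wlt W) g -> is_homeo (wlt W) g' ->
    (forall x, g' (g x) = x) -> (forall x, g (g' x) = x) ->
    forall x, Nat.iter 6 (fun x => t (g (t (g' x)))) x = x.

Lemma iter_ext {T} (f g : T -> T) n x : (forall x, f x = g x) ->
  Nat.iter n f x = Nat.iter n g x.
Proof. intros E; induction n; simpl; congruence. Qed.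

Lemma tr_transp_like (W : WOrd) (a b : W) :
  isol a -> isol b -> a <> b -> transp_like (tr a b).
Proof.
  intros Ha Hb N; split; [apply tr_homeo; auto|split; [|split]].
  - exists a; rewrite tr_l; auto.
  - apply tr_tr.
  - intros g g' Hg Hg' E E' x.
    transitivity (Nat.iter 6 (fun x => tr a b (tr (g a) (g b) x)) x).
    + apply iter_ext; intros y; rewrite (tr_conj g g'); auto.
    + apply tr_order; auto.
      intros K; apply N; rewrite <- (E a), <- (E b), K; auto.
Qed.

(** Suppose that [t] exchanges, besides [a] and [b], a second pair [c], [d] of isolated points. If
    it fixes a further isolated point, some product of [t] with a conjugate contains a 5-cycle; if
    not, [t] exchanges two further pairs and some product contains a 4-cycle. Both contradict the
    exponent 6. *)
Lemma transp_like_tr (W : WOrd) (t : W -> W) :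
  (forall l : list W, exists x, ~ In x l) -> transp_like t ->
  exists a b, isol a /\ isol b /\ a <> b /\ t = tr a b.
Proof.
  intros Inf [Ht [[x0 Hx0] [Inv Ord]]].
  assert (exists a, isol a /\ t a <> a) as [a [Ha Na]].
  { apply NNPP; intros N; apply Hx0.
    replace t with (fun x : W => x); auto; symmetry.
    apply cont_eq_isol; [apply homeo_cont; auto|apply cont_id|].
    intros i Hi; apply NNPP; eauto. }
  assert (Hm : forall y, isol y -> isol (t y)) by (intros; apply isol_is_homeo; auto).
  remember (t a) as b eqn:Tab; symmetry in Tab.
  assert (Tba : t b = a) by (rewrite <- Tab; auto).
  assert (Hb : isol b) by (rewrite <- Tab; auto).
  exists a, b; repeat split; auto.
  apply cont_eq_isol; [apply homeo_cont; auto|apply homeo_cont, tr_homeo; auto|].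
  intros c Hc.
  destruct (classic (c = a)) as [->|Nca]; [rewrite tr_l; auto|].
  destruct (classic (c = b)) as [->|Ncb]; [rewrite tr_r; auto|].
  rewrite tr_o by auto; apply NNPP; intros Nc.
  remember (t c) as d eqn:Tcd; symmetry in Tcd.
  assert (Tdc : t d = c) by (rewrite <- Tcd; auto).
  assert (Hd : isol d) by (rewrite <- Tcd; auto).
  assert (d <> a) by congruence.
  assert (d <> b) by congruence.
  assert (Fix : forall e, isol e -> e <> a -> e <> b -> e <> c -> e <> d ->
    t e = e -> False).
  { intros e He ? ? ? ? Te.
    (* [t] and its conjugate by the 3-cycle (a c e) multiply to a 5-cycle. *)
    specialize (Ord (fun x => tr a c (tr c e x)) (fun x => tr c e (tr a c x))).
    assert (E : t (tr a c (tr c e (t (tr c e (tr a c a))))) = b)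
      by (tr_simp; rewrite Te; tr_simp; auto).
    assert (E1 : t (tr a c (tr c e (t (tr c e (tr a c b))))) = d)
      by (tr_simp; rewrite Tba; tr_simp; auto).
    assert (E2 : t (tr a c (tr c e (t (tr c e (tr a c d))))) = e)
      by (tr_simp; rewrite Tdc; tr_simp; auto).
    assert (E3 : t (tr a c (tr c e (t (tr c e (tr a c e))))) = c)
      by (tr_simp; rewrite Tcd; tr_simp; auto).
    assert (E4 : t (tr a c (tr c e (t (tr c e (tr a c c))))) = a)
      by (tr_simp; rewrite Tab; tr_simp; auto).
    (* The 5-cycle is [a], [b], [d], [e], [c]; its sixth power is the cycle itself and sends [a] to
       [b]. *)
    apply Na; transitivity (Nat.iter 6
      (fun x => t (tr a c (tr c e (t (tr c e (tr a c x)))))) a); [|apply Ord].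
    + unfold Nat.iter, nat_rect; rewrite E, E1, E2, E3, E4, E; auto.
    + apply homeo_comp; apply tr_homeo; auto.
    + apply homeo_comp; apply tr_homeo; auto.
    + intros; rewrite !tr_tr; auto.
    + intros; rewrite !tr_tr; auto. }
  destruct (isol_notin W (a :: b :: c :: d :: nil) (Inf _)) as [e [He Ne]].
  simpl in Ne.
  assert (e <> a /\ e <> b /\ e <> c /\ e <> d) as (?&?&?&?)
    by (repeat split; intros ->; tauto).
  clear Ne.
  assert (Te : t e <> e) by eauto.
  remember (t e) as f eqn:Tef; symmetry in Tef.
  assert (Tfe : t f = e) by (rewrite <- Tef; auto).
  assert (Hf : isol f) by (rewrite <- Tef; auto).
  assert (f <> a) by congruence.
  assert (f <> b) by congruence.
  assert (f <> c) by congruence.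
  assert (f <> d) by congruence.
  destruct (isol_notin W (a :: b :: c :: d :: e :: f :: nil) (Inf _)) as [u [Hu Nu]].
  simpl in Nu.
  assert (u <> a /\ u <> b /\ u <> c /\ u <> d /\ u <> e /\ u <> f)
    as (?&?&?&?&?&?) by (repeat split; intros ->; auto 8).
  clear Nu.
  assert (Tu : t u <> u) by eauto.
  (* The 4-cycle (a c e u) commutes with its conjugate by [t]. *)
  remember (t u) as v eqn:Tuv; symmetry in Tuv.
  assert (Tvu : t v = u) by (rewrite <- Tuv; auto).
  assert (v <> a) by congruence.
  assert (v <> b) by congruence.
  assert (v <> c) by congruence.
  assert (v <> d) by congruence.
  assert (v <> e) by congruence.
  assert (v <> f) by congruence.
  specialize (Ord (fun x => tr a c (tr c e (tr e u x)))
                  (fun x => tr e u (tr c e (tr a c x)))).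
  assert (E : t (tr a c (tr c e (tr e u (t (tr e u (tr c e (tr a c b))))))) = d)
    by (tr_simp; rewrite Tba; tr_simp; auto).
  assert (E1 : t (tr a c (tr c e (tr e u (t (tr e u (tr c e (tr a c d))))))) = f)
    by (tr_simp; rewrite Tdc; tr_simp; auto).
  assert (E2 : t (tr a c (tr c e (tr e u (t (tr e u (tr c e (tr a c f))))))) = v)
    by (tr_simp; rewrite Tfe; tr_simp; auto).
  assert (E3 : t (tr a c (tr c e (tr e u (t (tr e u (tr c e (tr a c v))))))) = b)
    by (tr_simp; rewrite Tvu; tr_simp; auto).
  (* The product contains the 4-cycle [b], [d], [f], [v]; its sixth power is its square and sends
     [b] to [f]. *)
  assert (K : f = b); [|congruence].
  transitivity (Nat.iter 6
    (fun x => t (tr a c (tr c e (tr e u (t (tr e u (tr c e (tr a c x)))))))) b); [|apply Ord].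
  - unfold Nat.iter, nat_rect; rewrite E, E1, E2, E3, E, E1; auto.
  - apply (homeo_comp W (tr a c) (fun x => tr c e (tr e u x)));
      [|apply (homeo_comp W (tr c e) (tr e u))]; apply tr_homeo; auto.
  - apply (homeo_comp W (tr e u) (fun x => tr c e (tr a c x)));
      [|apply (homeo_comp W (tr c e) (tr a c))]; apply tr_homeo; auto.
  - intros; rewrite !tr_tr; auto.
  - intros; rewrite !tr_tr; auto.
Qed.

(** * Group isomorphisms induced by bijections of the isolated points *)

Definition infinite (T : Type) : Prop := forall l : list T, exists x, ~ In x l.

Definition grp_iso (W W' : WOrd) (F : (W -> W) -> (W' -> W'))
    (G : (W' -> W') -> (W -> W)) : Prop :=
  (forall f, is_homeo (wlt W) f -> is_homeo (wlt W') (F f)) /\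
  (forall g, is_homeo (wlt W') g -> is_homeo (wlt W) (G g)) /\
  (forall f, is_homeo (wlt W) f -> G (F f) = f) /\
  (forall g, is_homeo (wlt W') g -> F (G g) = g) /\
  (forall f1 f2, is_homeo (wlt W) f1 -> is_homeo (wlt W) f2 ->
     F (fun x => f1 (f2 x)) = (fun y => F f1 (F f2 y))).

Lemma grp_iso_sym (W W' : WOrd) F G : grp_iso W W' F G -> grp_iso W' W G F.
Proof.
  intros [HF [HG [GF [FG C]]]]; repeat split; auto.
  intros g1 g2 H1 H2.
  rewrite <- (GF (fun y => G g1 (G g2 y))) by (apply homeo_comp; auto).
  rewrite C, !FG; auto.
Qed.

Section GroupIso.

Context (W W' : WOrd) (F : (W -> W) -> (W' -> W')) (G : (W' -> W') -> (W -> W)).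
Hypothesis FG_iso : grp_iso W W' F G.

Lemma F_homeo f : is_homeo (wlt W) f -> is_homeo (wlt W') (F f).
Proof. apply FG_iso. Qed.

Lemma F_inj f1 f2 : is_homeo (wlt W) f1 -> is_homeo (wlt W) f2 ->
  F f1 = F f2 -> f1 = f2.
Proof.
  destruct FG_iso as [_ [_ [GF _]]]; intros H1 H2 E.
  rewrite <- (GF f1), <- (GF f2), E; auto.
Qed.

Lemma F_comp f1 f2 : is_homeo (wlt W) f1 -> is_homeo (wlt W) f2 ->
  F (fun x => f1 (f2 x)) = (fun y => F f1 (F f2 y)).
Proof. apply FG_iso. Qed.

Lemma F_id : F (fun x => x) = (fun y => y).
Proof.
  apply functional_extensionality; intros y.
  pose proof (homeo_id W) as H.
  apply (homeo_inj W' (F (fun x => x))); [apply F_homeo; auto|].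
  symmetry; exact (f_equal (fun h => h y) (F_comp _ _ H H)).
Qed.

Lemma F_inv f g : is_homeo (wlt W) f -> is_homeo (wlt W) g ->
  (forall x, f (g x) = x) -> forall y, F f (F g y) = y.
Proof.
  intros Hf Hg E y.
  change ((fun y => F f (F g y)) y = y).
  rewrite <- F_comp by auto.
  replace (fun x => f (g x)) with (fun x : W => x)
    by (apply functional_extensionality; auto).
  rewrite F_id; auto.
Qed.

Lemma iter_homeo f n : is_homeo (wlt W) f -> is_homeo (wlt W) (Nat.iter n f).
Proof.
  intros H; induction n; [exact (homeo_id W)|].
  exact (homeo_comp W f (Nat.iter n f) H IHn).
Qed.

Lemma F_iter f n : is_homeo (wlt W) f ->
  F (Nat.iter n f) = Nat.iter n (F f).
Proof.
  intros H; induction n; [exact F_id|].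
  change (F (fun x => f (Nat.iter n f x)) = (fun y => F f (Nat.iter n (F f) y))).
  rewrite F_comp, IHn; auto; apply iter_homeo; auto.
Qed.

(** The property is expressed in the group: conjugators of the target are pulled back along [G], and
    the resulting sixth-power identity is pushed forward along [F]. *)
Lemma F_transp_like t : transp_like t -> transp_like (F t).
Proof.
  intros [Ht [[x Nx] [Inv Ord]]].
  pose proof (grp_iso_sym _ _ _ _ FG_iso) as [HG [_ [FG [_ GC]]]].
  split; [apply F_homeo; auto|split; [|split]].
  - apply NNPP; intros N; apply Nx.
    assert (E : t = fun x => x).
    { apply F_inj; auto using homeo_id.
      rewrite F_id; apply functional_extensionality; intros y.
      apply NNPP; eauto. }
    rewrite E; auto.
  - apply F_inv; auto.
  - intros g g' Hg Hg' E E' y.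
    assert (Ginv : forall k k', is_homeo (wlt W') k -> is_homeo (wlt W') k' ->
      (forall x, k (k' x) = x) -> forall z, G k (G k' z) = z).
    { intros k k' Hk Hk' Ek z; change ((fun y => G k (G k' y)) z = z).
      assert (K : (fun y => G k (G k' y)) = fun y => y); [|rewrite K; auto].
      rewrite <- GC by auto; apply F_inj; auto using homeo_id, homeo_comp.
      rewrite FG, F_id by auto using homeo_comp.
      apply functional_extensionality; auto. }
    set (h := fun x => t (G g (t (G g' x)))).
    assert (Hh : is_homeo (wlt W) h).
    { apply (homeo_comp W t (fun x => G g (t (G g' x)))); auto.
      apply (homeo_comp W (G g) (fun x => t (G g' x))); auto.
      apply (homeo_comp W t (G g')); auto. }
    assert (Eh : F h = fun y => F t (g (F t (g' y)))).
    { unfold h.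
      rewrite (F_comp t (fun x => G g (t (G g' x)))); auto.
      rewrite (F_comp (G g) (fun x => t (G g' x))); auto.
      rewrite (F_comp t (G g')); auto.
      rewrite !FG; auto.
      - apply (homeo_comp W t (G g')); auto.
      - apply (homeo_comp W (G g) (fun x => t (G g' x))); auto.
        apply (homeo_comp W t (G g')); auto. }
    rewrite <- Eh, <- F_iter by auto.
    replace (Nat.iter 6 h) with (fun x : W => x).
    + rewrite F_id; auto.
    + apply functional_extensionality; intros x'; symmetry.
      apply Ord; auto.
Qed.

Hypotheses (Inf : infinite W) (Inf' : infinite W').

Lemma F_tr a b : isol a -> isol b -> a <> b ->
  exists p q, isol p /\ isol q /\ p <> q /\ F (tr a b) = tr p q.
Proof.
  intros Ha Hb N; apply transp_like_tr; auto.
  apply F_transp_like, tr_transp_like; auto.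
Qed.

Lemma F_tr_at a b x : isol a -> isol b -> a <> b -> F (tr a b) x <> x ->
  exists y, isol x /\ isol y /\ x <> y /\ F (tr a b) = tr x y.
Proof.
  intros Ha Hb N Hx; destruct (F_tr a b) as [p [q [Hp [Hq [Npq E]]]]]; auto.
  rewrite E in Hx |- *; destruct (tr_moves _ _ _ Hx) as [->| ->].
  - exists q; auto.
  - exists p; rewrite tr_sym; auto.
Qed.

(** The transposition of [b] and [c] is that of [a] and [c] conjugated by that of [a] and [b]. *)
Lemma F_tr_tr a b c y : isol a -> isol b -> isol c -> a <> b -> a <> c -> b <> c ->
  F (tr b c) y = F (tr a b) (F (tr a c) (F (tr a b) y)).
Proof.
  intros Ha Hb Hc Nab Nac Nbc.
  assert (E : tr b c = fun x => tr a b (tr a c (tr a b x))).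
  { apply functional_extensionality; intros x.
    rewrite (tr_conj (tr a b) (tr a b)) by apply tr_tr; tr_simp; auto. }
  rewrite E, (F_comp (tr a b) (fun x => tr a c (tr a b x))).
  - rewrite (F_comp (tr a c) (tr a b)); auto using tr_homeo.
  - apply tr_homeo; auto.
  - apply (homeo_comp W (tr a c) (tr a b)); apply tr_homeo; auto.
Qed.

(** The transpositions [tr a b] and [tr a c] do not commute, whereas a homeomorphism fixing both [p]
    and [q] commutes with [tr p q]. *)
Lemma F_tr_noncomm a b c p q : isol a -> isol b -> isol c ->
  a <> b -> a <> c -> b <> c -> F (tr a b) = tr p q ->
  F (tr a c) p <> p \/ F (tr a c) q <> q.
Proof.
  intros Ha Hb Hc Nab Nac Nbc E.
  apply NNPP; intros N.
  assert (Ep : F (tr a c) p = p) by (apply NNPP; tauto).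
  assert (Eq : F (tr a c) q = q) by (apply NNPP; tauto).
  assert (K : (fun x => tr a c (tr a b x)) = (fun x => tr a b (tr a c x))).
  { apply F_inj.
    - apply (homeo_comp W (tr a c) (tr a b)); apply tr_homeo; auto.
    - apply (homeo_comp W (tr a b) (tr a c)); apply tr_homeo; auto.
    - rewrite (F_comp (tr a c) (tr a b)), (F_comp (tr a b) (tr a c))
        by (apply tr_homeo; auto).
      apply functional_extensionality; intros y; rewrite E.
      assert (Hac := F_homeo (tr a c) (tr_homeo _ _ _ Ha Hc)).
      destruct (classic (y = p)) as [->|]; [rewrite Ep; tr_simp; auto|].
      destruct (classic (y = q)) as [->|]; [rewrite Eq; tr_simp; auto|].
      rewrite (tr_o p q y) by auto.
      rewrite tr_o; auto; intros Z.
      + apply (homeo_inj _ _ y p) in Hac; congruence.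
      + apply (homeo_inj _ _ y q) in Hac; congruence. }
  apply (f_equal (fun h => h a)) in K; revert K; tr_simp; auto.
Qed.

(* [p] is the common point of the transpositions [F (tr a b)], [b <> a]. *)
Definition star_point (a : W) (p : W') : Prop :=
  forall b, isol b -> b <> a -> F (tr a b) p <> p.

(** The images of two transpositions through [a] share exactly one point: at least one because they
    do not commute, not two because [F] is injective. It remains to see that the image of any third
    transposition through [a] moves this point too. *)
Lemma star_point_exists a : isol a -> exists p, star_point a p.
Proof.
  intros Ha.
  destruct (isol_notin W (a :: nil) (Inf _)) as [b [Hb Nb]].
  destruct (isol_notin W (a :: b :: nil) (Inf _)) as [c [Hc Nc]].
  simpl in Nb, Nc.
  assert (Nab : a <> b) by tauto.
  assert (Nac : a <> c) by tauto.
  assert (Nbc : b <> c) by tauto.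
  assert (exists p q r, q <> p /\ r <> p /\ q <> r /\ F (tr a b) = tr p q /\ F (tr a c) = tr p r)
    as [p [q [r [Nqp [Nrp [Nqr [Eb Ec]]]]]]].
  { destruct (F_tr a b) as [p0 [q0 [Hp [Hq [Npq E]]]]]; auto.
    assert (exists p q, q <> p /\ F (tr a b) = tr p q /\ F (tr a c) p <> p)
      as [p [q [Nqp [Eb M]]]].
    { destruct (F_tr_noncomm a b c p0 q0); auto.
      - exists p0, q0; auto.
      - exists q0, p0; rewrite (tr_sym q0 p0); auto. }
    destruct (F_tr_at a c p) as [r [_ [_ [Nr Ec]]]]; auto.
    exists p, q, r; repeat split; auto; intros ->.
    apply Nbc.
    assert (K : tr a b = tr a c) by (apply F_inj; auto using tr_homeo; congruence).
    apply (f_equal (fun h => h a)) in K; revert K; tr_simp; auto. }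
  exists p; intros d Hd Nd Fix.
  destruct (classic (d = b)) as [->|Ndb]; [rewrite Eb, tr_l in Fix; auto|].
  destruct (classic (d = c)) as [->|Ndc]; [rewrite Ec, tr_l in Fix; auto|].
  (* The three transpositions would form a triangle, but [tr b c] is already
     the third side of that triangle. *)
  destruct (F_tr_noncomm a b d p q) as [|Mq]; auto.
  destruct (F_tr_noncomm a c d p r) as [|Mr]; auto.
  destruct (F_tr_at a d q) as [s [_ [_ [Ns Ed]]]]; auto.
  assert (s = r) as ->.
  { rewrite Ed in Mr; destruct (tr_moves _ _ _ Mr); congruence. }
  assert (K : tr a d = tr b c).
  { apply F_inj; auto using tr_homeo.
    apply functional_extensionality; intros y.
    rewrite (F_tr_tr a b c) by auto.
    rewrite Ed, Eb, Ec.
    rewrite (tr_conj (tr p q) (tr p q)) by apply tr_tr; tr_simp; auto. }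
  apply (f_equal (fun h => h a)) in K; revert K; tr_simp; auto.
Qed.

(** If [F (tr a b) = tr p q] and [F (tr a c) = tr p r], then [F (tr b c)], obtained by conjugation,
    exchanges [q] and [r] and fixes [p]. *)
Lemma star_point_inj a b p : isol a -> isol b -> a <> b ->
  star_point a p -> star_point b p -> False.
Proof.
  intros Ha Hb Nab Sa Sb.
  destruct (isol_notin W (a :: b :: nil) (Inf _)) as [c [Hc Nc]].
  simpl in Nc.
  assert (Nac : a <> c) by tauto.
  assert (Nbc : b <> c) by tauto.
  apply (Sb c); auto.
  destruct (F_tr_at a b p) as [q [_ [_ [Nq Eab]]]]; auto.
  destruct (F_tr_at a c p) as [r [_ [_ [Nr Eac]]]]; auto.
  assert (Nqr : q <> r).
  { intros ->; apply Nbc.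
    assert (K : tr a b = tr a c) by (apply F_inj; auto using tr_homeo; congruence).
    apply (f_equal (fun h => h a)) in K; revert K; tr_simp; auto. }
  rewrite (F_tr_tr a b c), Eab, Eac by auto; tr_simp; auto.
Qed.

Lemma isol_map_exists : exists phi : W -> W',
  (forall a, isol a -> isol (phi a)) /\
  (forall a b, isol a -> isol b -> a <> b ->
     phi a <> phi b /\ F (tr a b) = tr (phi a) (phi b)).
Proof.
  destruct (Inf' nil) as [y0 _].
  (* A point that is not isolated receives the arbitrary value [y0]. *)
  assert (Ch : forall a, exists p, isol a -> star_point a p).
  { intros a; destruct (classic (isol a)) as [Ha|Na].
    - destruct (star_point_exists a Ha) as [p Hp]; eauto.
    - exists y0; tauto. }
  destruct (functional_choice _ Ch) as [phi S].
  exists phi; split.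
  - intros a Ha.
    destruct (isol_notin W (a :: nil) (Inf _)) as [b [Hb Nb]]; simpl in Nb.
    destruct (F_tr_at a b (phi a)) as [q [Hp _]]; auto.
    apply S; auto.
  - intros a b Ha Hb N.
    assert (Np : phi a <> phi b).
    { intros E; apply (star_point_inj a b (phi a)); auto; rewrite E; auto. }
    split; auto.
    destruct (F_tr_at a b (phi a)) as [q [_ [_ [Nq E]]]]; auto.
    { apply S; auto. }
    assert (M : F (tr a b) (phi b) <> phi b) by (rewrite tr_sym; apply S; auto).
    rewrite E in M; destruct (tr_moves _ _ _ M) as [|Eq]; congruence.
Qed.

End GroupIso.

(** [phi] and [psi] are the star point maps of [F] and of its inverse [G]. Testing on transpositions
    shows that they are mutually inverse and equivariant on isolated points. *)
Lemma isol_bijection (W W' : WOrd) F G : infinite W -> infinite W' ->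
  grp_iso W W' F G ->
  exists (phi : W -> W') (psi : W' -> W),
    (forall a, isol a -> isol (phi a) /\ psi (phi a) = a) /\
    (forall b, isol b -> isol (psi b) /\ phi (psi b) = b) /\
    (forall f a, is_homeo (wlt W) f -> isol a -> F f (phi a) = phi (f a)) /\
    (forall g b, is_homeo (wlt W') g -> isol b -> G g (psi b) = psi (g b)).
Proof.
  (* One direction, to be applied a second time with the two spaces exchanged. *)
  assert (Half : forall (W W' : WOrd) F G (phi : W -> W') (psi : W' -> W),
    infinite W -> grp_iso W W' F G ->
    (forall a, isol a -> isol (phi a)) ->
    (forall a b, isol a -> isol b -> a <> b ->
       phi a <> phi b /\ F (tr a b) = tr (phi a) (phi b)) ->
    (forall a, isol a -> isol (psi a)) ->
    (forall a b, isol a -> isol b -> a <> b ->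
       psi a <> psi b /\ G (tr a b) = tr (psi a) (psi b)) ->
    (forall a, isol a -> psi (phi a) = a) /\
    (forall f a, is_homeo (wlt W) f -> isol a -> F f (phi a) = phi (f a))).
  { clear; intros W W' F G phi psi Inf I Hphi Fphi Hpsi Gpsi; split.
    - intros a Ha.
      (* The map [G (F (tr a b)) = tr a b] moves [psi (phi a)], which is therefore [a] or [b]; the
         choice of [b] excludes the latter. *)
      destruct (isol_notin W (a :: psi (phi a) :: nil) (Inf _)) as [b [Hb Nb]].
      simpl in Nb.
      assert (Nab : a <> b) by auto.
      destruct (Fphi a b Ha Hb Nab) as [Np E].
      destruct (Gpsi (phi a) (phi b)) as [Nq E']; auto.
      rewrite <- E in E'.
      destruct I as [_ [_ [GF _]]]; rewrite GF in E' by (apply tr_homeo; auto).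
      destruct (tr_moves a b (psi (phi a))) as [K|K]; auto.
      + rewrite E', tr_l; auto.
      + exfalso; apply Nb; auto.
    - intros f a Hf Ha.
      (* By conjugation with [f], the map [F (tr (f a) (f b))] moves [F f (phi a)]. Two different
         choices of [b] then leave only [phi (f a)]. *)
      assert (K : forall b, isol b -> b <> a ->
        F f (phi a) = phi (f a) \/ F f (phi a) = phi (f b)).
      { intros b Hb Nb.
        destruct (homeo_inv _ f Hf) as [f' [Hf' [ff ff']]].
        assert (Nf : f a <> f b) by (intros Z; apply homeo_inj in Z; auto).
        destruct (Fphi (f a) (f b)) as [Np E]; auto using isol_is_homeo.
        destruct (Fphi a b) as [Np' E']; auto.
        apply tr_moves; rewrite <- E.
        replace (tr (f a) (f b)) with (fun x => f (tr a b (f' x))).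
        + rewrite (F_comp W W' F G I f (fun x => tr a b (f' x))),
            (F_comp W W' F G I (tr a b) f') by
            (auto using tr_homeo; apply (homeo_comp W (tr a b) f'); auto using tr_homeo).
          rewrite (F_inv W W' F G I f' f), E' by auto.
          rewrite tr_l; intros Z; apply homeo_inj in Z; auto.
          apply (F_homeo W W' F G I); auto.
        + apply functional_extensionality; intros x; apply tr_conj; auto. }
      destruct (isol_notin W (a :: nil) (Inf _)) as [b [Hb Nb]].
      destruct (isol_notin W (a :: b :: nil) (Inf _)) as [c [Hc Nc]].
      simpl in Nb, Nc.
      assert (b <> a) by auto.
      assert (c <> a) by auto.
      assert (f b <> f c) by (intros Z; apply homeo_inj in Z; auto).
      destruct (K b) as [|Eb]; auto.
      destruct (K c) as [|Ec]; auto.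
      destruct (Fphi (f b) (f c)) as [Np _]; auto using isol_is_homeo; congruence. }
  intros Inf Inf' I.
  pose proof (grp_iso_sym _ _ _ _ I) as I'.
  destruct (isol_map_exists W W' F G I Inf Inf') as [phi [Hphi Fphi]].
  destruct (isol_map_exists W' W G F I' Inf' Inf) as [psi [Hpsi Gpsi]].
  destruct (Half W W' F G phi psi) as [A B]; auto.
  destruct (Half W' W G F psi phi) as [A' B']; auto.
  exists phi, psi; split; [|split]; auto.
Qed.

(** * Traces of clopen sets *)

Section ClopenTraces.

Context (W : WOrd) (m : W).
Hypothesis m_max : forall x : W, x <<= m.

(** [m] bounds every sequence, so least upper bounds exist; compactness enters in this form. *)
Lemma lub_exists (s : nat -> W) :
  exists y, (forall n, s n <<= y) /\ forall z, z << y -> exists n, z << s n.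
Proof.
  destruct (wmin W (fun y => forall n, s n <<= y)) as [y [Hy Hmin]]; [eauto|].
  exists y; split; auto; intros z Hz.
  apply NNPP; intros N.
  assert (y <<= z); [|wo].
  apply Hmin; intros n; destruct (wle_or_lt W (s n) z); auto; exfalso; eauto.
Qed.

Lemma incr_lt (s : nat -> W) : (forall n, s n << s (S n)) ->
  forall i j, i < j -> s i << s j.
Proof.
  intros H i j L; induction L; auto; apply wlt_trans with (s m0); auto.
Qed.

Lemma incr_le (s : nat -> W) : (forall n, s n << s (S n)) ->
  forall i j, i <= j -> s i <<= s j.
Proof.
  intros H i j L; destruct (Nat.eq_dec i j) as [->|]; [left; auto|].
  right; apply incr_lt; auto; lia.
Qed.

Lemma incr_lt_inv (s : nat -> W) : (forall n, s n << s (S n)) ->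
  forall i j, s i << s j -> i < j.
Proof.
  intros H i j L; destruct (le_lt_dec j i) as [G|]; auto.
  pose proof (incr_le s H _ _ G); wo.
Qed.

Lemma lub_tail (s : nat -> W) (y : W) (a : option W) :
  (forall n, s n << s (S n)) -> (forall z, z << y -> exists n, z << s n) ->
  above a y -> exists N, forall n, N <= n -> above a (s n).
Proof.
  intros Hs Hl; destruct a as [a|]; simpl.
  - intros Ha; destruct (Hl a Ha) as [N HN]; exists N; intros n Hn.
    pose proof (incr_le s Hs _ _ Hn); wo.
  - exists 0; auto.
Qed.

Lemma incr_converges (s : nat -> W) (y : W) U :
  (forall n, s n << s (S n)) ->
  (forall n, s n <<= y) -> (forall z, z << y -> exists n, z << s n) ->
  nhd y U -> exists N, forall n, N <= n -> U (s n).
Proof.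
  intros Hs Hu Hl [a [Ha K]].
  destruct (lub_tail s y a Hs Hl Ha) as [N HN]; exists N; auto.
Qed.

(** The closure of the set of isolated points satisfying [C]. *)
Definition adherent (C : W -> Prop) (x : W) : Prop :=
  forall U, nhd x U -> exists i, isol i /\ C i /\ U i.

(* [C], restricted to the isolated points, is the trace of a clopen set. *)
Definition clopen_trace (C : W -> Prop) : Prop :=
  forall x, adherent C x -> adherent (fun i => ~ C i) x -> False.

(* The failure of [clopen_trace C], expressed through the action of the
   homeomorphism group on the isolated points only. *)
Definition switchable (C : W -> Prop) : Prop :=
  exists c d : nat -> W,
    (forall n, isol (c n) /\ C (c n)) /\
    (forall n, isol (d n) /\ ~ C (d n)) /\
    (forall i j, c i = c j -> i = j) /\
    forall M : nat -> bool, exists f, is_homeo (wlt W) f /\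
      forall n, f (c n) = if M n then d n else c n.

(** [mu k] is an index from [k] on whose term is least in that tail. Successive tail minima never
    decrease, and injectivity of [c] makes them increase strictly. *)
Lemma increasing_subsequence (c : nat -> W) : (forall i j, c i = c j -> i = j) ->
  exists p : nat -> nat, (forall n, p n < p (S n)) /\ forall n, c (p n) << c (p (S n)).
Proof.
  intros Hc.
  assert (Ch : forall k, exists j, k <= j /\ forall i, k <= i -> c j <<= c i).
  { intros k.
    destruct (wmin W (fun y => exists j, k <= j /\ y = c j)) as [y [[j [Hj ->]] Hmin]].
    - exists (c k), k; auto.
    - exists j; split; auto; intros i Hi; apply Hmin; eauto. }
  destruct (functional_choice _ Ch) as [mu Hmu].
  set (p := fix p n := match n with 0 => mu 0 | S n => mu (S (p n)) end).
  assert (Hp : forall n i, p n <= i -> c (p n) <<= c i).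
  { intros [|n] i Hi; simpl in *; apply Hmu.
    - lia.
    - pose proof (proj1 (Hmu (S (p n)))); lia. }
  assert (Lp : forall n, p n < p (S n)).
  { intros n; simpl; pose proof (proj1 (Hmu (S (p n)))); lia. }
  exists p; split; auto; intros n.
  specialize (Lp n); destruct (Hp n (p (S n))) as [E|]; auto; [lia|].
  apply Hc in E; lia.
Qed.

(** Along an increasing subsequence with supremum [y], only the terms of even position are switched.
    The unmoved terms force [f y = y], while the switched ones put [f y] in the closure of the
    complement of [C]. *)
Lemma switchable_not_clopen (C : W -> Prop) : switchable C -> clopen_trace C -> False.
Proof.
  intros [c [d [Hc [Hd [Ic Sw]]]]] T.
  destruct (increasing_subsequence c Ic) as [p [Hp Hs]].
  assert (Ip : forall i j, p i = p j -> i = j).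
  { assert (L : forall i j, i < j -> p i < p j).
    { intros i j L; induction L; [auto|specialize (Hp m0); lia]. }
    intros i j E; destruct (Nat.lt_trichotomy i j) as [G|[G|G]]; auto;
      apply L in G; lia. }
  destruct (lub_exists (fun n => c (p n))) as [y [Hu Hl]].
  set (s := fun n => c (p n)) in *.
  destruct (Sw (fun j => if excluded_middle_informative (exists n, j = p (2 * n))
                         then true else false)) as [f [Hf Ef]].
  assert (Cf := homeo_cont _ _ Hf); rewrite cont_nhd in Cf.
  assert (Even : forall n, f (s (2 * n)) = d (p (2 * n))).
  { intros n; unfold s; rewrite Ef.
    destruct excluded_middle_informative as [|N]; auto; exfalso; eauto. }
  assert (Odd : forall n, f (s (2 * n + 1)) = s (2 * n + 1)).
  { intros n; unfold s; rewrite Ef.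
    destruct excluded_middle_informative as [[k E]|]; auto.
    apply Ip in E; lia. }
  assert (Fy : f y = y).
  { apply NNPP; intros N.
    destruct (nhd_hausdorff _ _ _ N) as [U [V [HU [HV D]]]].
    destruct (incr_converges s y _ Hs Hu Hl (nhd_and _ _ _ _ (Cf _ _ HU) HV))
      as [k Hk].
    destruct (Hk (2 * k + 1)) as [K1 K2]; [lia|].
    rewrite Odd in K1; eauto. }
  apply (T y).
  - intros U HU; destruct (incr_converges s y _ Hs Hu Hl HU) as [k Hk].
    exists (s k); unfold s; split; [|split]; try apply Hc; apply Hk; auto.
  - intros U HU; rewrite <- Fy in HU.
    destruct (incr_converges s y _ Hs Hu Hl (Cf _ _ HU)) as [k Hk].
    exists (f (s (2 * k))); rewrite Even; split; [|split]; try apply Hd.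
    rewrite <- Even; apply Hk; lia.
Qed.

(** Apart from the limit [y] and the terms of [e], every point has a neighbourhood missing [e],
    where [f] is the identity. At [y], continuity holds because [tau] lowers an index by at most
    one, so that tails go to tails. *)
Lemma shuffle_cont (e : nat -> W) (y : W) (tau : nat -> nat) (f : W -> W) :
  (forall n, e n << e (S n)) -> (forall n, isol (e n)) ->
  (forall n, e n <<= y) -> (forall z, z << y -> exists n, z << e n) ->
  (forall n, n <= S (tau n)) ->
  (forall n, f (e n) = e (tau n)) ->
  (forall w, (forall n, w <> e n) -> f w = w) ->
  cont (wlt W) (wlt W) f.
Proof.
  intros He Ie Hu Hl Ht Fe Fo; apply cont_nhd; intros w U HU.
  destruct (classic (exists n, w = e n)) as [[n ->]|N].
  { eapply nhd_mono; [exact (Ie n)|]; simpl; intros z ->; exact (nhd_self _ _ _ HU). }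
  assert (Nw : forall n, w <> e n) by (intros n E; eauto).
  rewrite Fo in HU by auto.
  assert (Away : nhd w (fun z => forall n, z <> e n) -> nhd w (fun z => U (f z))).
  { intros H; eapply nhd_mono; [exact (nhd_and _ _ _ _ HU H)|].
    simpl; intros z [? ?]; rewrite Fo; auto. }
  destruct (classic (exists n, w << e n)) as [Ex|Nex].
  - destruct (dec_inh_nat_subset_has_unique_least_element (fun n => w << e n))
      as [n [[Hn Hmin] _]]; auto; [intros; apply classic|].
    (* As [n] is the least index with [w << e n], no term of [e] lies between [e (n - 1)] and
       [w]. *)
    apply Away; destruct n as [|n].
    + exists None; split; simpl; auto; intros z _ Hz j ->.
      pose proof (incr_le e He 0 j); assert (e 0 <<= e j) by (apply H; lia); wo.
    + assert (L : e n << w).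
      { destruct (wle_or_lt W w (e n)) as [[E|E]|E]; auto.
        - exfalso; exact (Nw _ E).
        - specialize (Hmin n E); lia. }
      exists (Some (e n)); split; auto; simpl; intros z Hz Hzw j ->.
      apply (incr_lt_inv e He) in Hz.
      pose proof (incr_le e He (S n) j Hz); wo.
  - assert (Hyw : y <<= w).
    { destruct (wle_or_lt W y w) as [|L]; auto; exfalso; auto. }
    destruct Hyw as [<-|Lyw].
    + destruct HU as [a [Ha K]].
      destruct (lub_tail e y a He Hl Ha) as [k Hk].
      exists (Some (e k)); split; simpl.
      * destruct (Hu k) as [E|]; auto; exfalso; exact (Nw k (eq_sym E)).
      * intros z Hz Hzy.
        destruct (classic (exists n, z = e n)) as [[n ->]|Nz].
        (* From [e k << e n] follows [k < n <= S (tau n)], hence [k <= tau n]. *)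
        -- rewrite Fe; apply K; auto; apply Hk.
           apply (incr_lt_inv e He) in Hz; specialize (Ht n); lia.
        -- rewrite Fo by (intros n E; eauto).
           apply K; auto; apply above_le with (e k); [auto|right; auto].
    + apply Away; exists (Some y); split; auto; simpl; intros z Hz _ n ->.
      specialize (Hu n); wo.
Qed.

Definition swap_pairs (M : nat -> bool) (n : nat) : nat :=
  if M (Nat.div2 n) then (if Nat.even n then S n else pred n) else n.

Lemma swap_pairs_even M k : swap_pairs M (2 * k) = if M k then 2 * k + 1 else 2 * k.
Proof.
  unfold swap_pairs; rewrite Nat.div2_double, Nat.even_even.
  destruct (M k); lia.
Qed.

Lemma swap_pairs_odd M k : swap_pairs M (2 * k + 1) = if M k then 2 * k else 2 * k + 1.
Proof.
  unfold swap_pairs; replace (2 * k + 1) with (S (2 * k)) by lia.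
  rewrite Nat.div2_succ_double, Nat.even_succ, Nat.odd_even; auto.
Qed.

Lemma swap_pairs_invol M n : swap_pairs M (swap_pairs M n) = n.
Proof.
  destruct (Nat.Even_or_Odd n) as [[k ->]|[k ->]].
  - rewrite swap_pairs_even; destruct (M k) eqn:E;
      [rewrite swap_pairs_odd|rewrite swap_pairs_even]; rewrite E; auto.
  - rewrite swap_pairs_odd; destruct (M k) eqn:E;
      [rewrite swap_pairs_even|rewrite swap_pairs_odd]; rewrite E; auto.
Qed.

Lemma swap_pairs_ge M n : n <= S (swap_pairs M n).
Proof. unfold swap_pairs; destruct (M _), (Nat.even n); lia. Qed.

Lemma swap_pairs_homeo (e : nat -> W) (y : W) (M : nat -> bool) :
  (forall n, e n << e (S n)) -> (forall n, isol (e n)) ->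
  (forall n, e n <<= y) -> (forall z, z << y -> exists n, z << e n) ->
  exists f, is_homeo (wlt W) f /\ forall n, f (e n) = e (swap_pairs M n).
Proof.
  intros He Ie Hu Hl.
  assert (Ch : forall w, exists v, (forall n, w = e n -> v = e (swap_pairs M n)) /\
                             ((forall n, w <> e n) -> v = w)).
  { intros w; destruct (classic (exists n, w = e n)) as [[n ->]|N].
    - exists (e (swap_pairs M n)); split.
      + intros k E; f_equal; f_equal.
        destruct (Nat.lt_trichotomy n k) as [L|[L|L]]; auto;
          apply (incr_lt e He) in L; rewrite E in L; exfalso; exact (wlt_irrefl _ _ L).
      + intros K; exfalso; exact (K n eq_refl).
    - exists w; split; auto; intros n E; exfalso; eauto. }
  destruct (functional_choice _ Ch) as [f Hf].
  assert (Fe : forall n, f (e n) = e (swap_pairs M n)) by (intros n; apply Hf; auto).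
  assert (Fo : forall w, (forall n, w <> e n) -> f w = w) by (intros w; apply Hf).
  exists f; split; auto.
  assert (Inv : forall w, f (f w) = w).
  { intros w; destruct (classic (exists n, w = e n)) as [[n ->]|N].
    - rewrite !Fe, swap_pairs_invol; auto.
    - rewrite !(Fo w); auto; intros n E; eauto. }
  assert (Cf := shuffle_cont e y _ f He Ie Hu Hl (swap_pairs_ge M) Fe Fo).
  exists f; auto.
Qed.

(** A point [x] adherent to both sides is not isolated, so an increasing sequence of isolated points
    below [x] can be chosen that alternates between [C] and its complement. Consecutive terms are
    then exchanged pairwise. *)
Lemma not_clopen_switchable (C : W -> Prop) : ~ clopen_trace C -> switchable C.
Proof.
  intros N.
  assert (exists x, adherent C x /\ adherent (fun i => ~ C i) x) as [x [Hx Hx']].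
  { apply NNPP; intros K; apply N; intros x H H'; eauto. }
  assert (Nx : ~ isol x).
  { intros I; destruct (Hx _ I) as [i [_ [Hi ->]]].
    destruct (Hx' _ I) as [j [_ [Hj ->]]]; auto. }
  (* In [(n, a)], the parity of [n] prescribes the side of the next term and [a] is the previous
     term. *)
  assert (Ch : forall na : nat * W, exists b, snd na << x ->
    snd na << b /\ b << x /\ isol b /\ (Nat.even (fst na) = true <-> C b)).
  { intros [n a]; simpl.
    destruct (classic (a << x)) as [L|]; [|exists a; tauto].
    assert (HU := nhd_and _ _ _ _ (nhd_gt W x a L) (nhd_le W x x (or_introl eq_refl))).
    assert (exists b, isol b /\ (Nat.even n = true <-> C b) /\ a << b /\ b <<= x)
      as [b [Ib [Hb [Lb [->|Lx]]]]].
    - destruct (Nat.even n).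
      + destruct (Hx _ HU) as [b [Ib [Cb [? ?]]]].
        exists b; repeat split; auto.
      + destruct (Hx' _ HU) as [b [Ib [Cb [? ?]]]].
        exists b; repeat split; auto; intros; (discriminate || contradiction).
    - contradiction.
    - exists b; tauto. }
  destruct (functional_choice _ Ch) as [st Hst].
  destruct (Hx _ (nhd_le W x x (or_introl eq_refl))) as [a0 [Ia0 [_ [->|La0]]]];
    [contradiction|].
  set (e := fix e n := match n with 0 => st (0, a0) | S n => st (S n, e n) end).
  assert (Lx : forall n, e n << x).
  { induction n as [|n IH].
    - apply (Hst (0, a0)); auto.
    - apply (Hst (S n, e n)); auto. }
  assert (He : forall n, e n << e (S n)).
  { intros n; apply (Hst (S n, e n)), Lx. }
  assert (Ie : forall n, isol (e n) /\ (Nat.even n = true <-> C (e n))).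
  { intros [|n].
    - apply (Hst (0, a0)); auto.
    - apply (Hst (S n, e n)), Lx. }
  (* The supremum [y] of the sequence may lie strictly below [x]. *)
  destruct (lub_exists e) as [y [Hu Hl]].
  exists (fun n => e (2 * n)), (fun n => e (2 * n + 1)); split; [|split; [|split]].
  - intros n; split; apply Ie; apply Nat.even_even.
  - intros n; split; [apply Ie|].
    intros K; apply Ie in K; rewrite Nat.even_odd in K; discriminate.
  - intros i j E; destruct (Nat.lt_trichotomy i j) as [L|[L|L]]; auto; exfalso.
    + assert (L' : 2 * i < 2 * j) by lia; apply (incr_lt e He) in L'.
      rewrite E in L'; exact (wlt_irrefl _ _ L').
    + assert (L' : 2 * j < 2 * i) by lia; apply (incr_lt e He) in L'.
      rewrite E in L'; exact (wlt_irrefl _ _ L').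
  - intros M; destruct (swap_pairs_homeo e y M He (fun n => proj1 (Ie n)) Hu Hl)
      as [f [Hf Ef]].
    exists f; split; auto; intros n; rewrite Ef, swap_pairs_even.
    destruct (M n); auto.
Qed.

(** * Closures of sets of isolated points *)

Lemma adherent_mono (C D : W -> Prop) x :
  (forall i, isol i -> C i -> D i) -> adherent C x -> adherent D x.
Proof. intros S H U HU; destruct (H U HU) as [i [? [? ?]]]; exists i; auto. Qed.

Lemma adherent_or (C D : W -> Prop) x :
  adherent (fun i => C i \/ D i) x -> adherent C x \/ adherent D x.
Proof.
  intros H; apply NNPP; intros N.
  assert (K : exists U V, nhd x U /\ nhd x V /\
    forall i, isol i -> U i -> V i -> ~ C i /\ ~ D i).
  { apply not_or_and in N; destruct N as [N1 N2].
    apply not_all_ex_not in N1; destruct N1 as [U N1].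
    apply not_all_ex_not in N2; destruct N2 as [V N2].
    apply imply_to_and in N1; apply imply_to_and in N2.
    destruct N1 as [HU N1], N2 as [HV N2].
    exists U, V; repeat split; auto; intros K; [apply N1|apply N2]; exists i; auto. }
  destruct K as [U [V [HU [HV K]]]].
  destruct (H _ (nhd_and _ _ _ _ HU HV)) as [i [Ii [[Ci|Di] [Ui Vi]]]];
    destruct (K i Ii Ui Vi); auto.
Qed.

Lemma adherent_all (C : W -> Prop) x : (forall i, isol i -> C i) -> adherent C x.
Proof.
  intros H U HU; destruct (isol_dense _ _ _ HU) as [i [? ?]]; exists i; auto.
Qed.

Lemma not_adherent (C : W -> Prop) x : ~ adherent C x ->
  exists U, nhd x U /\ forall i, isol i -> U i -> ~ C i.
Proof.
  intros N; apply not_all_ex_not in N; destruct N as [U N].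
  apply imply_to_and in N; destruct N as [HU N].
  exists U; split; auto; intros i Ii Ui Ci; apply N; eauto.
Qed.

(** The closure of a clopen trace is open: [x] has a neighbourhood whose isolated points all satisfy
    [C], and by density that neighbourhood lies in the closure. *)
Lemma adherent_nhd (C : W -> Prop) x :
  clopen_trace C -> adherent C x -> nhd x (adherent C).
Proof.
  intros T Hx.
  destruct (not_adherent (fun i => ~ C i) x) as [U [[a [Ha K]] D]].
  { intros Hx'; exact (T x Hx Hx'). }
  exists a; split; auto; intros z Hz Hzx V [b [Hb L]].
  destruct (isol_dense W z (fun w => U w /\ V w)) as [i [Ii [Ui Vi]]].
  - eapply nhd_mono; [exact (nhd_and W z _ _ (ex_intro _ a (conj Hz (fun y p q => conj p q)))
      (ex_intro _ b (conj Hb L)))|].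
    simpl; intros y [[? ?] ?]; split; auto; apply K; auto; wo.
  - exists i; repeat split; auto; apply NNPP; intros Ci; exact (D i Ii Ui Ci).
Qed.

(** Intervals (a, x] are closed: a point outside lies either at most at [a] or beyond [x], and both
    regions are open. *)
Lemma adherent_interval (a : option W) (x z : W) :
  adherent (fun i => above a i /\ i <<= x) z -> above a z /\ z <<= x.
Proof.
  intros H; apply NNPP; intros N.
  destruct (H (fun i => ~ (above a i /\ i <<= x))) as [i [_ [? ?]]]; auto.
  destruct (wle_or_lt W z x) as [L|L].
  - exists None; split; simpl; auto; intros y _ Hyz [Hy _]; apply N; split; auto.
    apply above_le with y; auto.
  - eapply nhd_mono; [exact (nhd_gt W z x L)|]; simpl; intros y Hy [_ ?]; wo.
Qed.

Lemma interval_clopen_trace (a : option W) (x : W) :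
  clopen_trace (fun i => above a i /\ i <<= x).
Proof.
  intros z H H'.
  destruct (adherent_interval a x z H) as [Ha Hx].
  destruct (H' (fun i => above a i /\ i <<= x)) as [i [_ [? ?]]]; auto.
  exists a; split; auto; intros y Hy Hyz; split; auto; wo.
Qed.

End ClopenTraces.

(** * Extension to a homeomorphism *)

(** [switchable] speaks only of the action on isolated points, so equivariance carries a witness for
    the preimage of [C] in [W'] to one for [C] in [W]. *)
Lemma clopen_trace_transport (W W' : WOrd) (m : W) (m' : W')
    (phi : W -> W') (psi : W' -> W) (G : (W' -> W') -> (W -> W)) (C : W -> Prop) :
  (forall x, x <<= m) -> (forall y, y <<= m') ->
  (forall b, isol b -> isol (psi b) /\ phi (psi b) = b) ->
  (forall g, is_homeo (wlt W') g -> is_homeo (wlt W) (G g)) ->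
  (forall g b, is_homeo (wlt W') g -> isol b -> G g (psi b) = psi (g b)) ->
  clopen_trace W C -> clopen_trace W' (fun b => C (psi b)).
Proof.
  intros Hm Hm' Hpsi HG Eq T; apply NNPP; intros N.
  apply (not_clopen_switchable W' m' Hm') in N.
  destruct N as [c [d [Hc [Hd [Ic Sw]]]]].
  apply (switchable_not_clopen W m Hm C); auto.
  exists (fun n => psi (c n)), (fun n => psi (d n)); split; [|split; [|split]].
  - intros n; split; [apply Hpsi|]; apply Hc.
  - intros n; split; [apply Hpsi|]; apply Hd.
  - intros i j E; apply Ic.
    rewrite <- (proj2 (Hpsi (c i) (proj1 (Hc i)))), E; apply Hpsi, Hc.
  - intros M; destruct (Sw M) as [g [Hg Eg]]; exists (G g); split; auto.
    intros n; rewrite Eq, Eg by (auto; apply Hc); destruct (M n); auto.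
Qed.

Lemma clopen_trace_compl (W : WOrd) (C : W -> Prop) :
  clopen_trace W C -> clopen_trace W (fun i => ~ C i).
Proof.
  intros T x H H'; apply (T x); auto.
  eapply adherent_mono; [|exact H']; simpl; intros; apply NNPP; auto.
Qed.

Lemma nhd_adherent (W : WOrd) (C : W -> Prop) x : nhd x C -> adherent W C x.
Proof.
  intros H U HU; destruct (isol_dense W x _ (nhd_and _ _ _ _ H HU)) as [i [? [? ?]]].
  exists i; auto.
Qed.

(** Continuous extension of [phi], phrased through clopen traces: if [h x] lies in the closure of
    such a trace, then [x] lies in the closure of its preimage. *)
Definition extends (W W' : WOrd) (phi h : W -> W') : Prop :=
  forall x C, clopen_trace W' C -> adherent W' C (h x) ->
    adherent W (fun i => C (phi i)) x.

(** [h x] is the least [y] such that the isolated points with [phi i <<= y] accumulate at [x]. A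
    clopen trace adherent to [h x] contains all isolated points of some (a, h x], and by minimality
    the preimage of this interval accumulates at [x]. *)
Lemma extension_exists (W W' : WOrd) (m' : W') (phi : W -> W') :
  (forall y, y <<= m') -> (forall a, isol a -> isol (phi a)) ->
  exists h, extends W W' phi h.
Proof.
  intros Hm Hphi.
  assert (Ch : forall x, exists y, adherent W (fun i => phi i <<= y) x /\
    forall z, adherent W (fun i => phi i <<= z) x -> y <<= z).
  { intros x; apply wmin; exists m'; apply adherent_all; auto. }
  destruct (functional_choice _ Ch) as [h Hh]; exists h.
  intros x C T HC; destruct (Hh x) as [H1 H2].
  destruct (not_adherent W' (fun i => ~ C i) (h x)) as [U [[a [Ha K]] D]].
  { intros HC'; exact (T _ HC HC'). }
  destruct (adherent_or W (fun i => ~ above a (phi i))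
              (fun i => above a (phi i) /\ phi i <<= h x) x) as [N|Y].
  - eapply adherent_mono; [|exact H1]; simpl; intros i _ ?.
    destruct (classic (above a (phi i))); auto.
  (* Here the points with [phi i <<= a] accumulate at [x], so minimality would give [h x <<= a]. *)
  - exfalso; destruct a as [a|]; simpl in *.
    + assert (h x <<= a); [|wo].
      apply H2; eapply adherent_mono; [|exact N]; simpl; intros i _ ?.
      destruct (wle_or_lt W' (phi i) a); tauto.
    + destruct (N (fun _ => True)) as [i [_ [? _]]]; auto.
      exists None; simpl; auto.
  - eapply adherent_mono; [|exact Y]; simpl; intros i Ii [? ?].
    apply NNPP; apply D; auto.
Qed.

(** Points [y] near [x] stay in the closure of the preimage of (a, h x]. If [h y] were outside that
    interval, [y] would also be adherent to the complement of the preimage, which is a clopen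
    trace. *)
Lemma extension_cont (W W' : WOrd) (phi h : W -> W') :
  (forall C, clopen_trace W' C -> clopen_trace W (fun i => C (phi i))) ->
  extends W W' phi h -> cont (wlt W) (wlt W') h.
Proof.
  intros Tr E; apply cont_nhd; intros x U [a [Ha K]].
  set (C := fun i => above a i /\ i <<= h x).
  assert (T : clopen_trace W' C) by apply interval_clopen_trace.
  assert (HC : adherent W (fun i => C (phi i)) x).
  { apply E; auto; apply nhd_adherent; exists a; split; auto; split; auto. }
  eapply nhd_mono; [exact (adherent_nhd W _ x (Tr _ T) HC)|].
  simpl; intros y Hy.
  assert (Hd : adherent W' (fun i => C i \/ ~ C i) (h y)).
  { apply adherent_all; intros; apply classic. }
  apply adherent_or in Hd; destruct Hd as [Hd|Hd].
  - apply adherent_interval in Hd; apply K; apply Hd.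
  - exfalso; apply (Tr _ T y); auto.
    exact (E y _ (clopen_trace_compl _ _ T) Hd).
Qed.

(** Otherwise some interval ending at [k (h x)] misses [x]. Pulled back along [psi] and then [phi],
    it returns to itself on isolated points, so [x] is adherent to it; but it is closed. *)
Lemma extension_inverse (W W' : WOrd) (phi h : W -> W') (psi k : W' -> W) :
  (forall C, clopen_trace W C -> clopen_trace W' (fun i => C (psi i))) ->
  (forall a, isol a -> psi (phi a) = a) ->
  extends W W' phi h -> extends W' W psi k -> forall x, k (h x) = x.
Proof.
  intros Tr Inv Eh Ek x; apply NNPP; intros N.
  assert (exists a, above a (k (h x)) /\ ~ (above a x /\ x <<= k (h x))) as [a [Ha Na]].
  { destruct (wle_or_lt W x (k (h x))) as [[L|L]|L].
    - congruence.
    - exists (Some x); split; simpl; auto; intros [K _]; exact (wlt_irrefl _ _ K).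
    - exists None; split; simpl; auto; intros [_ [K|K]]; [congruence|wo]. }
  apply Na, adherent_interval.
  assert (T := interval_clopen_trace W a (k (h x))).
  assert (H : adherent W (fun i => above a i /\ i <<= k (h x)) (k (h x))).
  { apply nhd_adherent; exists a; auto. }
  apply (Ek _ _ T) in H; apply (Eh _ _ (Tr _ T)) in H.
  eapply adherent_mono; [|exact H]; simpl; intros i Ii; rewrite Inv; auto.
Qed.

Lemma infinite_reconstruction (W W' : WOrd) (m : W) (m' : W') F G :
  (forall x, x <<= m) -> (forall y, y <<= m') ->
  infinite W -> infinite W' -> grp_iso W W' F G ->
  homeomorphic (wlt W) (wlt W').
Proof.
  intros Hm Hm' Inf Inf' I.
  destruct (isol_bijection W W' F G Inf Inf' I) as [phi [psi [Hphi [Hpsi [EF EG]]]]].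
  assert (T : forall C, clopen_trace W C -> clopen_trace W' (fun b => C (psi b))).
  { intros C; apply (clopen_trace_transport W W' m m' phi psi G); auto; apply I. }
  assert (T' : forall C, clopen_trace W' C -> clopen_trace W (fun b => C (phi b))).
  { intros C; apply (clopen_trace_transport W' W m' m psi phi F); auto; apply I. }
  destruct (extension_exists W W' m' phi) as [h Hh]; auto.
  { intros a Ha; apply Hphi; auto. }
  destruct (extension_exists W' W m psi) as [k Hk]; auto.
  { intros a Ha; apply Hpsi; auto. }
  exists h, k; split; [|split; [|split]].
  - apply (extension_inverse W W' phi h psi k); auto; apply Hphi.
  - apply (extension_inverse W' W psi k phi h); auto; apply Hpsi.
  - apply (extension_cont W W' phi); auto.
  - apply (extension_cont W' W psi); auto.
Qed.

(** * Finite spaces *)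

(** Permutations of N letters as plain functions constrained only below [N]; this is the interface
    between counting permutations and permuting points of a space. *)
Definition inverse_below (N : nat) (f f' : nat -> nat) : Prop :=
  forall i, i < N -> f i < N /\ f' i < N /\ f' (f i) = i /\ f (f' i) = i.

Module Counting.
Import all_boot all_fingroup.

(** [Phi] would yield an injective map from the permutations of n + 1 letters to those of n letters.
    Positivity of [n] matters because 1! = 0!. *)
Lemma no_perm_embedding (n : nat) (Phi : (nat -> nat) -> (nat -> nat)) :
  lt 0 n ->
  (forall f f', inverse_below n.+1 f f' ->
     (forall i, lt i n -> lt (Phi f i) n) /\
     (forall i j, lt i n -> lt j n -> Phi f i = Phi f j -> i = j)) ->
  (forall f f' g g', inverse_below n.+1 f f' -> inverse_below n.+1 g g' ->
     (forall i, lt i n -> Phi f i = Phi g i) -> forall i, lt i n.+1 -> f i = g i) ->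
  False.
Proof.
move=> n0 H1 H2.
pose ext (s : 'S_n.+1) (i : nat) : nat := s (inord i).
have extE (s : 'S_n.+1) : inverse_below n.+1 (ext s) (ext s^-1%g).
  move=> i /ltP Hi; rewrite /ext !inord_val permK permKV inordK //.
  by do !split=> //; apply/ltP; rewrite ltn_ord.
have lt_n s (j : 'I_n) : Phi (ext s) j < n.
  by apply/ltP; apply: (proj1 (H1 _ _ (extE s))); apply/ltP.
pose psi s : {ffun 'I_n -> 'I_n} := [ffun j => Ordinal (lt_n s j)].
have psi_inj s : injective (psi s).
  move=> i j; rewrite !ffunE => /(congr1 val) /= E; apply: val_inj.
  by apply: (proj2 (H1 _ _ (extE s))) E; apply/ltP.
pose q s := perm (@psi_inj s).
have q_inj : injective q.
  move=> s t E; apply/permP => i; apply: val_inj.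
  have := H2 _ _ _ _ (extE s) (extE t) _ i (ltP (ltn_ord i)).
  rewrite /ext inord_val; apply=> j /ltP Hj.
  have := congr1 (fun p : 'S_n => val (p (Ordinal Hj))) E.
  by rewrite /= !permE !ffunE.
have := leq_card q q_inj.
rewrite !card_Sn factS; move/ltP: n0 => n0; rewrite leqNgt => /negP; apply.
by rewrite ltn_Pmull // fact_gt0.
Qed.
End Counting.

Lemma cont_off_isolated (W : WOrd) (l : list W) (f : W -> W) :
  (forall i, In i l -> isol i) -> (forall w, ~ In w l -> f w = w) ->
  cont (wlt W) (wlt W) f.
Proof.
  intros Il Fo; apply cont_nhd; intros w U HU.
  destruct (classic (In w l)) as [Hw|Hw].
  - eapply nhd_mono; [exact (Il w Hw)|]; simpl; intros z ->; exact (nhd_self _ _ _ HU).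
  - rewrite Fo in HU by auto.
    eapply nhd_mono; [exact (nhd_and _ _ _ _ HU (nhd_notin W l w Hw))|].
    simpl; intros z [? ?]; rewrite Fo; auto.
Qed.

(** Permutations of the n + 1 isolated points in [l'], extended by the identity, are homeomorphisms
    of [W'], even if [W'] is infinite. [F] would inject them into the permutations of the n points
    of [W]. *)
Lemma no_homeo_embedding (W W' : WOrd) (l : list W) (l' : list W')
    (F : (W' -> W') -> (W -> W)) :
  (forall x, In x l) -> NoDup l -> inhabited W ->
  (forall y, In y l' -> isol y) -> NoDup l' -> length l' = S (length l) ->
  (forall f, is_homeo (wlt W') f -> is_homeo (wlt W) (F f)) ->
  (forall f g, is_homeo (wlt W') f -> is_homeo (wlt W') g -> F f = F g -> f = g) ->
  False.
Proof.
  intros Al Nl [x0] Il' Nl' Len FH Finj.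
  assert (exists y0 : W', True) as [y0 _] by (destruct l'; [discriminate|eauto]).
  set (n := length l) in *.
  (* [f] acts on positions in [l']; points off the list stay fixed. *)
  assert (Ch : forall fx : (nat -> nat) * W', exists y,
    (forall i, i < S n -> snd fx = nth i l' y0 -> y = nth (fst fx i) l' y0) /\
    (~ In (snd fx) l' -> y = snd fx)).
  { intros [f x]; simpl; destruct (classic (In x l')) as [Hx|Hx].
    - destruct (In_nth l' x y0 Hx) as [i [Hi Ei]].
      exists (nth (f i) l' y0); split; [|tauto].
      intros j Hj Ej; f_equal; f_equal.
      apply (proj1 (NoDup_nth l' y0) Nl'); try lia; congruence.
    - exists x; split; auto; intros i Hi ->; exfalso; apply Hx, nth_In; lia. }
  destruct (functional_choice _ Ch) as [act0 Hact]; clear Ch.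
  set (act := fun f x => act0 (f, x)).
  assert (A1 : forall f i, i < S n -> act f (nth i l' y0) = nth (f i) l' y0).
  { intros f i Hi; apply (Hact (f, nth i l' y0)); auto. }
  assert (A2 : forall f x, ~ In x l' -> act f x = x).
  { intros f x; apply (Hact (f, x)). }
  assert (A3 : forall f f', inverse_below (S n) f f' -> forall x, act f' (act f x) = x).
  { intros f f' B x; destruct (classic (In x l')) as [Hx|Hx].
    - destruct (In_nth l' x y0 Hx) as [i [Hi <-]].
      rewrite Len in Hi; destruct (B i Hi) as [? [? [E ?]]].
      rewrite !A1, E; auto.
    - rewrite !(A2 _ x); auto. }
  assert (Sym : forall f f', inverse_below (S n) f f' -> inverse_below (S n) f' f).
  { intros f f' B i Hi; destruct (B i Hi) as [? [? [? ?]]]; auto. }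
  assert (AH : forall f f', inverse_below (S n) f f' -> is_homeo (wlt W') (act f)).
  { intros f f' B; exists (act f'); repeat split.
    - apply A3; auto.
    - apply A3; auto.
    - apply (cont_off_isolated W' l'); auto.
    - apply (cont_off_isolated W' l'); auto. }
  assert (Cx : forall x : W, exists j, j < n /\ nth j l x0 = x).
  { intros x; apply In_nth; auto. }
  destruct (functional_choice _ Cx) as [idx Hidx]; clear Cx.
  assert (Hn : 0 < n) by (destruct (Hidx x0); lia).
  apply (Counting.no_perm_embedding n (fun f j => idx (F (act f) (nth j l x0)))); auto.
  - intros f f' B; split.
    + intros i Hi; apply Hidx.
    + intros i j Hi Hj E.
      apply (proj1 (NoDup_nth l x0) Nl); auto.
      apply (homeo_inj W (F (act f))); [apply FH; eauto|].
      rewrite <- (proj2 (Hidx (F (act f) (nth i l x0)))), E; apply Hidx.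
  - intros f f' g g' B B' E i Hi.
    assert (K : act f = act g).
    { apply Finj; eauto; apply functional_extensionality; intros x.
      destruct (In_nth l x x0 (Al x)) as [j [Hj <-]].
      rewrite <- (proj2 (Hidx (F (act f) (nth j l x0)))), E by auto; apply Hidx. }
    destruct (B i Hi) as [Bi _]; destruct (B' i Hi) as [Bi' _].
    apply (proj1 (NoDup_nth l' y0) Nl'); try lia.
    rewrite <- !A1, K by auto; auto.
Qed.

(** Isolated points are added one at a time: density provides a new one as long as the list does not
    exhaust the space. *)
Lemma isol_list_or_finite (W : WOrd) (k : nat) :
  (exists l : list W, (forall y, In y l -> isol y) /\ NoDup l /\ length l = k) \/
  (exists l : list W, (forall y, In y l) /\ NoDup l /\ length l < k).
Proof.
  induction k as [|k [[l [Il [Nl Len]]]|[l [Al [Nl Len]]]]].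
  - left; exists nil; repeat split; [intros y []|constructor].
  - destruct (classic (exists x, ~ In x l)) as [E|N].
    + left; destruct (isol_notin W l E) as [i [Ii Ni]].
      exists (i :: l); repeat split; [|constructor; auto|simpl; lia].
      intros y [<-|Hy]; auto.
    + right; exists l; repeat split; auto; [|lia].
      intros y; apply NNPP; eauto.
  - right; exists l; repeat split; auto.
Qed.

Lemma finite_isol (W : WOrd) (l : list W) (x : W) : (forall y, In y l) -> isol x.
Proof.
  intros Al.
  set (dec := fun a b : W => excluded_middle_informative (a = b)).
  eapply nhd_mono.
  - apply (nhd_notin W (remove dec x l) x), remove_In.
  - intros y Hy; destruct (dec y x) as [|N]; auto.
    exfalso; apply Hy, in_in_remove; auto.
Qed.

Lemma finite_cont (W W' : WOrd) (l : list W) (f : W -> W') :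
  (forall y, In y l) -> cont (wlt W) (wlt W') f.
Proof.
  intros Al; apply cont_nhd; intros x U HU.
  eapply nhd_mono; [exact (finite_isol W l x Al)|].
  simpl; intros y ->; exact (nhd_self _ _ _ HU).
Qed.

(** Counting permutations in both directions shows that [W'] is finite with as many points as [W].
    All points are then isolated, so matching two enumerations is a homeomorphism. *)
Lemma finite_reconstruction (W W' : WOrd) (m : W) (m' : W') (l : list W) F G :
  grp_iso W W' F G -> (forall x, In x l) -> homeomorphic (wlt W) (wlt W').
Proof.
  intros I Al0.
  assert (exists l : list W, (forall x, In x l) /\ NoDup l) as [l1 [Al Nl]].
  { exists (nodup (fun a b => excluded_middle_informative (a = b)) l); split.
    - intros x; apply nodup_In; auto.
    - apply NoDup_nodup. }
  pose proof (grp_iso_sym _ _ _ _ I) as I'.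
  destruct (isol_list_or_finite W' (S (length l1)))
    as [[l' [Il' [Nl' Len]]]|[l' [Al' [Nl' Len]]]].
  { exfalso; apply (no_homeo_embedding W W' l1 l' G); auto.
    - exact (proj1 I').
    - apply (F_inj W' W G F I'). }
  destruct (isol_list_or_finite W (S (length l')))
    as [[l2 [Il2 [Nl2 Len2]]]|[l2 [Al2 [Nl2 Len2]]]].
  { exfalso; apply (no_homeo_embedding W' W l' l2 F); auto.
    - exact (proj1 I).
    - apply (F_inj W W' F G I). }
  assert (Len3 : length l1 <= length l2).
  { apply NoDup_incl_length; auto; intros x _; auto. }
  assert (Ch : forall x : W, exists y : W', exists i,
    i < length l1 /\ nth i l1 m = x /\ nth i l' m' = y).
  { intros x; destruct (In_nth l1 x m (Al x)) as [i [? ?]]; eauto 6. }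
  assert (Ch' : forall y : W', exists x : W, exists i,
    i < length l' /\ nth i l1 m = x /\ nth i l' m' = y).
  { intros x; destruct (In_nth l' x m' (Al' x)) as [i [? ?]]; eauto 6. }
  destruct (functional_choice _ Ch) as [f Hf].
  destruct (functional_choice _ Ch') as [g Hg].
  exists f, g; split; [|split; [|split]].
  - intros x; destruct (Hf x) as [i [Hi [Ei Ei']]].
    destruct (Hg (f x)) as [j [Hj [Ej Ej']]].
    rewrite <- Ej, <- Ei; f_equal.
    apply (proj1 (NoDup_nth l' m') Nl'); try lia; congruence.
  - intros y; destruct (Hg y) as [i [Hi [Ei Ei']]].
    destruct (Hf (g y)) as [j [Hj [Ej Ej']]].
    rewrite <- Ej', <- Ei'; f_equal.
    apply (proj1 (NoDup_nth l1 m) Nl); try lia; congruence.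
  - apply (finite_cont W W' l1); auto.
  - apply (finite_cont W' W l'); auto.
Qed.

Lemma homeomorphic_sym (T T' : Type) (lt : T -> T -> Prop) (lt' : T' -> T' -> Prop) :
  homeomorphic lt lt' -> homeomorphic lt' lt.
Proof. intros [f [g [? [? [? ?]]]]]; exists g, f; auto. Qed.

Lemma not_infinite (T : Type) : ~ infinite T -> exists l : list T, forall x, In x l.
Proof.
  intros N; apply not_all_ex_not in N; destruct N as [l N].
  exists l; intros x; apply NNPP; eauto.
Qed.

Lemma reconstruction (W W' : WOrd) (m : W) (m' : W') :
  (forall x, x <<= m) -> (forall y, y <<= m') ->
  top_grp_iso (wlt W) (wlt W') -> homeomorphic (wlt W) (wlt W').
Proof.
  intros Hm Hm' [F [G [HF [HG [GF [FG [C _]]]]]]].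
  assert (I : grp_iso W W' F G) by (repeat split; auto).
  destruct (classic (infinite W)) as [Inf|Fin].
  - destruct (classic (infinite W')) as [Inf'|Fin'].
    + exact (infinite_reconstruction W W' m m' F G Hm Hm' Inf Inf' I).
    + destruct (not_infinite _ Fin') as [l Al].
      apply homeomorphic_sym.
      exact (finite_reconstruction W' W m' m l G F (grp_iso_sym _ _ _ _ I) Al).
  - destruct (not_infinite _ Fin) as [l Al].
    exact (finite_reconstruction W W' m m' l F G I Al).
Qed.

(** * Powers of omega and ranks *)

Lemma sig_ext {T : Type} (P : T -> Prop) (u v : {x | P x}) :
  proj1_sig u = proj1_sig v -> u = v.
Proof.
  destruct u as [u Hu], v as [v Hv]; simpl; intros ->; f_equal; apply proof_irrelevance.
Qed.

Section OmegaPower.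

Context (A : WOrd).

Notation "f $ a" := (proj1_sig f a) (at level 9, format "f $ a").

Lemma list_max_exists (P : A -> Prop) (l : list A) :
  (exists x, In x l /\ P x) ->
  exists x, P x /\ forall y, In y l -> P y -> y <<= x.
Proof.
  induction l as [|z l IH]; intros [x [Hx Px]]; [destruct Hx|].
  destruct (classic (exists x, In x l /\ P x)) as [E|N].
  - destruct (IH E) as [w [Pw Hw]].
    destruct (classic (P z)) as [Pz|Nz].
    + destruct (wle_or_lt A z w) as [L|L].
      * exists w; split; auto; intros y [<-|Hy] Py; auto.
      * exists z; split; auto; intros y [<-|Hy] Py; [left; auto|].
        specialize (Hw y Hy Py); wo.
    + exists w; split; auto; intros y [<-|Hy] Py; [contradiction|auto].
  - destruct Hx as [->|Hx]; [|exfalso; eauto].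
    exists x; split; auto; intros y [<-|Hy] Py; [left; auto|exfalso; eauto].
Qed.

Lemma om_ext (f g : OmPow A) : (forall a, f$a = g$a) -> f = g.
Proof. intros E; apply sig_ext, functional_extensionality; auto. Qed.

Lemma om_max_diff (f g : OmPow A) : f <> g ->
  exists a, f$a <> g$a /\ forall b, a << b -> f$b = g$b.
Proof.
  intros N.
  destruct (proj2_sig f) as [l Hl], (proj2_sig g) as [l' Hl'].
  assert (Hin : forall a, f$a <> g$a -> In a (l ++ l')).
  { intros a Na; apply in_or_app; destruct (Nat.eq_dec (f$a) 0) as [E|]; auto.
    right; apply Hl'; congruence. }
  destruct (list_max_exists (fun a => f$a <> g$a) (l ++ l')) as [a [Ha Hmax]].
  - apply NNPP; intros K; apply N, om_ext; intros a.
    apply NNPP; intros Na; apply K; exists a; auto.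
  - exists a; split; auto; intros b Hb; apply NNPP; intros Nb.
    pose proof (Hmax b (Hin b Nb) Nb); wo.
Qed.

Definition om_zero : OmPow A.
Proof. exists (fun _ => 0), nil; intros a H; exact (H eq_refl). Defined.

Definition update (f : A -> nat) (a : A) (n : nat) (b : A) : nat :=
  if excluded_middle_informative (b = a) then n else f b.

Lemma update_eq f a n : update f a n a = n.
Proof. unfold update; destruct excluded_middle_informative; congruence. Qed.

Lemma update_neq f a n b : b <> a -> update f a n b = f b.
Proof. unfold update; destruct excluded_middle_informative; congruence. Qed.

Definition om_update (f : OmPow A) (a : A) (n : nat) : OmPow A.
Proof.
  exists (update (proj1_sig f) a n).
  destruct (proj2_sig f) as [l Hl]; exists (a :: l); intros b Hb.
  destruct (classic (b = a)) as [->|N]; [left; auto|right].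
  apply Hl; rewrite update_neq in Hb; auto.
Defined.

(** The ordinal sum g + omega^c: exponents below [c] are absorbed and the coefficient at [c] grows
    by one. *)
Definition bump (c : A) (g : OmPow A) : OmPow A.
Proof.
  exists (fun d => if excluded_middle_informative (c << d) then g$d
                   else if excluded_middle_informative (d = c) then S (g$d) else 0).
  destruct (proj2_sig g) as [l Hl]; exists (c :: l); intros d.
  destruct excluded_middle_informative; [right; auto|].
  destruct excluded_middle_informative; [left; auto|tauto].
Defined.

Lemma bump_above c g d : c << d -> (bump c g)$d = g$d.
Proof. simpl; destruct excluded_middle_informative; tauto. Qed.

Lemma bump_at c g : (bump c g)$c = S (g$c).
Proof.
  simpl; destruct excluded_middle_informative as [H|];
    [exfalso; exact (wlt_irrefl _ _ H)|].
  destruct excluded_middle_informative; tauto.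
Qed.

Lemma bump_supp c g d : (bump c g)$d <> 0 -> c <<= d.
Proof.
  simpl; destruct excluded_middle_informative; [right; auto|].
  destruct excluded_middle_informative; [left; auto|tauto].
Qed.

Lemma om_lt_irrefl (f : OmPow A) : ~ om_lt A f f.
Proof. intros [a [H _]]; lia. Qed.

Lemma om_lt_trans (f g h : OmPow A) : om_lt A f g -> om_lt A g h -> om_lt A f h.
Proof.
  intros [a [Ha Ka]] [b [Hb Kb]].
  destruct (wlt_total A a b) as [L|[->|L]].
  - exists b; rewrite (Ka b L); split; auto.
    intros c Hc; rewrite Ka, Kb; auto; wo.
  - exists b; split; [lia|]; intros c Hc; rewrite Ka; auto.
  - exists a; rewrite <- (Kb a L); split; auto.
    intros c Hc; rewrite Ka, Kb; auto; wo.
Qed.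

Lemma om_lt_total (f g : OmPow A) : om_lt A f g \/ f = g \/ om_lt A g f.
Proof.
  destruct (classic (f = g)) as [|N]; auto.
  destruct (om_max_diff f g N) as [a [Ha K]].
  assert (f$a < g$a \/ g$a < f$a) as [L|L] by lia.
  - left; exists a; auto.
  - right; right; exists a; split; auto; intros b Hb; rewrite K; auto.
Qed.

Lemma om_zero_least (f : OmPow A) : ~ om_lt A f om_zero.
Proof. intros [a [H _]]; simpl in H; lia. Qed.

Definition supp_le (a : A) (f : OmPow A) : Prop := forall b, f$b <> 0 -> b <<= a.

Lemma om_zero_or_lead (f : OmPow A) : f = om_zero \/
  exists a, f$a <> 0 /\ supp_le a f.
Proof.
  destruct (classic (f = om_zero)) as [|N]; auto; right.
  destruct (om_max_diff f om_zero N) as [a [Ha K]]; exists a; split; auto.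
  intros b Hb; destruct (wle_or_lt A b a) as [|L]; auto.
  exfalso; apply Hb; rewrite K; auto.
Qed.

(** Nested induction on a bound [a] for the exponents, on the coefficient at [a], and on the
    remainder obtained by erasing that coefficient. *)
Lemma om_acc_lead (a : A) (f : OmPow A) : supp_le a f -> Acc (om_lt A) f.
Proof.
  revert f; induction (wlt_wf A a) as [a _ IH].
  assert (Low : forall f, (forall b, f$b <> 0 -> b << a) -> Acc (om_lt A) f).
  { intros f Hf; destruct (om_zero_or_lead f) as [->|[b [Hb Lb]]]; [|eauto].
    constructor; intros g Hg; exfalso; exact (om_zero_least _ Hg). }
  assert (H : forall n f, supp_le a f -> f$a = n -> Acc (om_lt A) f).
  { induction n as [n IHn] using lt_wf_ind; intros f Hf Ef.
    assert (Hr : Acc (om_lt A) (om_update f a 0)).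
    { apply Low; intros b; simpl; destruct (classic (b = a)) as [->|N].
      - rewrite update_eq; tauto.
      - rewrite update_neq by auto; intros Hb; destruct (Hf b Hb); tauto. }
    (* A smaller [g] either has a smaller coefficient at [a], or the same coefficient and a smaller
       remainder. *)
    remember (om_update f a 0) as r eqn:Er; revert f Hf Ef Er.
    induction Hr as [r _ IHr]; intros f Hf Ef ->.
    constructor; intros g [b [Hb K]].
    assert (Lb : b <<= a) by (apply Hf; lia).
    assert (Hg : supp_le a g).
    { intros c Hc; destruct (wle_or_lt A c a) as [|L]; auto.
      apply Hf; rewrite <- K; auto; wo. }
    destruct Lb as [->|Lb].
    - apply (IHn (g$a)); auto; lia.
    - assert (Ea : g$a = f$a) by auto.
      apply (IHr (om_update g a 0)); auto; [|lia].
      exists b; simpl; split.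
      + rewrite !update_neq by (apply wlt_neq; auto); auto.
      + intros c Hc; destruct (classic (c = a)) as [->|N].
        * rewrite !update_eq; auto.
        * rewrite !update_neq by auto; auto. }
  eauto.
Qed.

Lemma om_lt_wf : well_founded (om_lt A).
Proof.
  intros f; destruct (om_zero_or_lead f) as [->|[a [_ H]]].
  - constructor; intros g Hg; exfalso; exact (om_zero_least _ Hg).
  - exact (om_acc_lead a f H).
Qed.

Lemma omk_lt_wf k : well_founded (omk_lt A k).
Proof.
  assert (H : forall n f (i : Fin k), proj1_sig i = n -> Acc (omk_lt A k) (f, i)).
  { induction n as [n IHn] using lt_wf_ind; intros f.
    induction (om_lt_wf f) as [f _ IHf]; intros i Ei.
    constructor; intros [g j] [L|[E L]]; simpl in *.
    - apply (IHn (proj1_sig j)); auto; lia.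
    - subst j; auto. }
  intros [f i]; eauto.
Qed.

Definition OmKOrd (k : nat) : WOrd.
Proof.
  refine {| wcar := OmK A k; wlt := omk_lt A k; wlt_wf := omk_lt_wf k |}.
  - intros [f i] [L|[_ L]]; simpl in *; [lia|exact (om_lt_irrefl _ L)].
  - intros [f i] [g j] [h l] [L|[E L]] [L'|[E' L']]; unfold omk_lt; simpl in *; subst.
    + left; lia.
    + left; lia.
    + left; lia.
    + right; split; auto; exact (om_lt_trans _ _ _ L L').
  - intros [f i] [g j]; unfold omk_lt; simpl.
    destruct (Nat.lt_trichotomy (proj1_sig i) (proj1_sig j)) as [L|[E|L]]; auto.
    apply sig_ext in E; subst j.
    destruct (om_lt_total f g) as [L|[->|L]]; auto.
Defined.

End OmegaPower.

(** * Adjoining a top point; abstract Cantor-Bendixson ranks and their invariance *)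

Definition SuccOrd (W : WOrd) : WOrd.
Proof.
  assert (AccS : forall x : W, Acc (succ_lt (wlt W)) (Some x)).
  { intros x; induction (wlt_wf W x) as [x _ IH].
    constructor; intros [y|] H; simpl in H; [auto|destruct H]. }
  refine {| wcar := option W; wlt := succ_lt (wlt W) |}.
  - intros [x|] H; simpl in H; [exact (wlt_irrefl _ _ H)|exact H].
  - intros [x|] [y|] [z|]; simpl; try tauto; apply wlt_trans.
  - intros [x|] [y|]; simpl; auto.
    destruct (wlt_total W x y) as [|[->|]]; auto.
  - intros [x|]; auto; constructor; intros [y|] H; simpl in H; [auto|destruct H].
Defined.

Lemma SuccOrd_max (W : WOrd) (x : SuccOrd W) : @wle (SuccOrd W) x None.
Proof. destruct x; [right; exact I|left; auto]. Qed.

Definition cb_rank (W R : WOrd) (rk : W -> R) : Prop :=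
  (forall x, nhd x (fun y => y <> x -> rk y << rk x)) /\
  (forall x r U, r << rk x -> nhd x U -> exists y, y <> x /\ U y /\ rk y = r) /\
  (forall r, exists x, rk x = r).

Lemma cb_rank_mono (W W' R R' : WOrd) (rk : W -> R) (rk' : W' -> R')
    (h : W -> W') (g : W' -> W) :
  cb_rank W R rk -> cb_rank W' R' rk' ->
  (forall x, g (h x) = x) -> (forall y, h (g y) = y) ->
  cont (wlt W) (wlt W') h -> cont (wlt W') (wlt W) g ->
  forall x y, rk x <<= rk y -> rk' (h x) <<= rk' (h y).
Proof.
  intros [P1 [P2 _]] [P1' [P2' _]] gh hg Ch Cg.
  rewrite cont_nhd in Ch, Cg.
  assert (H : forall a x y, rk x = a -> a <<= rk y -> rk' (h x) <<= rk' (h y));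
    [|eauto].
  induction a as [a IH] using (well_founded_ind (wlt_wf R)); intros x y <- Hxy.
  destruct (wle_or_lt R' (rk' (h x)) (rk' (h y))) as [|L]; auto; exfalso.
  assert (N : nhd (h x) (fun z => g z <> x -> rk (g z) << rk x)).
  { apply (Cg (h x) (fun z => z <> x -> rk z << rk x)); rewrite gh; auto. }
  destruct (P2' (h x) _ _ L N) as [z [Nz [Hz Ez]]].
  assert (Lz : rk (g z) << rk x) by (apply Hz; intros E; apply Nz; rewrite <- E, hg; auto).
  assert (N' : nhd y (fun w => h w <> h y -> rk' (h w) << rk' (h y))).
  { apply (Ch y (fun w => w <> h y -> rk' w << rk' (h y))), P1'. }
  assert (Lzy : rk (g z) << rk y) by wo.
  destruct (P2 y _ _ Lzy N') as [w [Nw [Hw Ew]]].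
  assert (Lw : rk' (h w) << rk' (h y)).
  { apply Hw; intros E; apply Nw; rewrite <- (gh w), E, gh; auto. }
  assert (K : rk' (h (g z)) <<= rk' (h w)).
  { apply (IH (rk (g z)) Lz); auto; rewrite Ew; left; auto. }
  rewrite hg, Ez in K; wo.
Qed.

Lemma cb_rank_iso (W W' R R' : WOrd) (rk : W -> R) (rk' : W' -> R')
    (h : W -> W') (g : W' -> W) :
  cb_rank W R rk -> cb_rank W' R' rk' ->
  (forall x, g (h x) = x) -> (forall y, h (g y) = y) ->
  cont (wlt W) (wlt W') h -> cont (wlt W') (wlt W) g ->
  exists (th : R -> R') (th' : R' -> R),
    (forall r, th' (th r) = r) /\ (forall r, th (th' r) = r) /\
    (forall r s, r << s <-> th r << th s) /\
    (forall x, th (rk x) = rk' (h x)).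
Proof.
  intros P P' gh hg Ch Cg.
  assert (M : forall x y, rk x <<= rk y <-> rk' (h x) <<= rk' (h y)).
  { intros x y; split.
    - apply (cb_rank_mono W W' R R' rk rk' h g); auto.
    - intros H; rewrite <- (gh x), <- (gh y).
      apply (cb_rank_mono W' W R' R rk' rk g h); auto. }
  assert (Lt : forall x y, rk x << rk y <-> rk' (h x) << rk' (h y)).
  { intros x y; split; intros L.
    - destruct (wle_or_lt _ (rk' (h y)) (rk' (h x))) as [K|]; auto.
      apply M in K; exfalso; wo.
    - destruct (wle_or_lt _ (rk y) (rk x)) as [K|]; auto.
      apply M in K; exfalso; wo. }
  assert (Eq : forall x y, rk x = rk y <-> rk' (h x) = rk' (h y)).
  { intros x y; split; intros E.
    - destruct (wlt_total _ (rk' (h x)) (rk' (h y))) as [L|[|L]]; auto;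
        apply Lt in L; rewrite E in L; exfalso; exact (wlt_irrefl _ _ L).
    - destruct (wlt_total _ (rk x) (rk y)) as [L|[|L]]; auto;
        apply Lt in L; rewrite E in L; exfalso; exact (wlt_irrefl _ _ L). }
  destruct (functional_choice _ (proj2 (proj2 P))) as [pt Hpt].
  destruct (functional_choice _ (proj2 (proj2 P'))) as [pt' Hpt'].
  exists (fun r => rk' (h (pt r))), (fun r => rk (g (pt' r))); repeat split.
  - intros r; rewrite <- (Hpt r) at 2; apply Eq; rewrite hg, Hpt'; auto.
  - intros r; rewrite <- (Hpt' r) at 2; rewrite <- (hg (pt' r)).
    apply Eq; rewrite Hpt, hg; auto.
  - intros L; apply Lt; rewrite !Hpt; auto.
  - intros L; apply Lt in L; rewrite !Hpt in L; auto.
  - intros x; apply Eq; rewrite Hpt; auto.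
Qed.

Lemma SuccOrd_iso (A A' : WOrd) (th : SuccOrd A -> SuccOrd A') (th' : SuccOrd A' -> SuccOrd A) :
  (forall r, th' (th r) = r) -> (forall r, th (th' r) = r) ->
  (forall r s, r << s <-> th r << th s) ->
  th None = None /\ ord_iso A A'.
Proof.
  intros E E' L.
  assert (L' : forall r s, r << s <-> th' r << th' s).
  { intros r s; rewrite L, !E'; tauto. }
  assert (N : th None = None).
  { destruct (th None) as [a|] eqn:K; auto; exfalso.
    assert (H : wlt (SuccOrd A') (Some a) None) by exact I.
    rewrite L', <- K, E in H; exact H. }
  assert (N' : th' None = None) by (rewrite <- N, E; auto).
  split; auto.
  assert (Ch : forall a : A, exists a' : A', th (Some a) = Some a').
  { intros a; destruct (th (Some a)) as [a'|] eqn:K; [eauto|].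
    rewrite <- N in K; apply (f_equal th') in K; rewrite !E in K; discriminate. }
  assert (Ch' : forall a : A', exists a' : A, th' (Some a) = Some a').
  { intros a; destruct (th' (Some a)) as [a'|] eqn:K; [eauto|].
    rewrite <- N' in K; apply (f_equal th) in K; rewrite !E' in K; discriminate. }
  destruct (functional_choice _ Ch) as [f Hf].
  destruct (functional_choice _ Ch') as [f' Hf'].
  exists f, f'; split; [|split].
  - intros x; assert (K : Some (f' (f x)) = Some x); [|congruence].
    rewrite <- Hf', <- Hf, E; auto.
  - intros x; assert (K : Some (f (f' x)) = Some x); [|congruence].
    rewrite <- Hf, <- Hf', E'; auto.
  - intros x y; specialize (L (Some x) (Some y)); rewrite !Hf in L; exact L.
Qed.

(** * The rank function of [0, omega^alpha * k] *)

Definition SpOrd (A : WOrd) (k : nat) : WOrd := SuccOrd (OmKOrd A k).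

Section Rank.

Context (A : WOrd) (k : nat).
Hypothesis k_pos : 0 < k.

Notation "f $ a" := (proj1_sig f a) (at level 9, format "f $ a").

(* The rank of a point is the least [r] with [rank_cand x r], where [None]
   stands for the ordinal A: it is the least exponent of the Cantor normal
   form of the point, except that the point 0, which has no exponent, is
   isolated and thus gets the least rank. *)
Definition rank_cand (x : SpOrd A k) (r : SuccOrd A) : Prop :=
  match x, r with
  | Some p, Some a => (fst p)$a <> 0 \/ (fst p = om_zero A /\ proj1_sig (snd p) = 0)
  | None, Some _ => False
  | _, None => True
  end.

Definition is_rank (x : SpOrd A k) (r : SuccOrd A) : Prop :=
  rank_cand x r /\ forall s, rank_cand x s -> r <<= s.

Lemma rank_exists : exists rk : SpOrd A k -> SuccOrd A, forall x, is_rank x (rk x).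
Proof.
  apply functional_choice; intros x; apply wmin.
  exists None; destruct x; exact I.
Qed.

Definition fin0 : Fin k := exist _ 0 k_pos.

Definition origin : SpOrd A k := Some (om_zero A, fin0).

Lemma origin_least (x : SpOrd A k) : origin <<= x.
Proof.
  destruct (wle_or_lt _ origin x) as [|L]; auto; exfalso.
  destruct x as [[f i]|]; [|exact L].
  destruct L as [L|[_ L]]; simpl in L; [lia|exact (om_zero_least _ _ L)].
Qed.

Lemma om_zero_lt (f : OmPow A) : om_lt A (om_zero A) f -> exists a, f$a <> 0.
Proof. intros [a [H _]]; exists a; simpl in H; lia. Qed.

Lemma om_zero_dec (f : OmPow A) : f = om_zero A \/ exists a, f$a <> 0.
Proof.
  destruct (om_zero_or_lead A f) as [|[a [Ha _]]]; auto; right; eauto.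
Qed.

Context (rk : SpOrd A k -> SuccOrd A).
Hypothesis rk_rank : forall x, is_rank x (rk x).

Lemma rk_unique x r : is_rank x r -> rk x = r.
Proof.
  intros [H K]; destruct (rk_rank x) as [H' K'].
  specialize (K _ H'); specialize (K' _ H).
  destruct K as [|K]; auto; exfalso; wo.
Qed.

Lemma rk_le_exponent f (i : Fin k) a : f$a <> 0 -> rk (Some (f, i)) <<= (Some a : SuccOrd A).
Proof. intros H; apply rk_rank; left; exact H. Qed.

Lemma rk_bump c g (j : Fin k) : rk (Some (bump A c g, j)) = Some c.
Proof.
  assert (B : (bump A c g)$c <> 0) by (rewrite bump_at; lia).
  apply rk_unique; split; [left; exact B|].
  intros [d|] H; [|right; exact I].
  destruct H as [H|[H _]]; simpl fst in H.
  - destruct (bump_supp A c g d H) as [->|L]; [left; auto|right; exact L].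
  - rewrite H in B; exfalso; exact (B eq_refl).
Qed.

Lemma rk_top : rk None = None.
Proof. apply rk_unique; split; [exact I|]; intros [a|] H; [destruct H|left; auto]. Qed.

Lemma rk_some_lt_top f (i : Fin k) : (exists a, f$a <> 0) ->
  rk (Some (f, i)) << (None : SuccOrd A).
Proof.
  intros [a Ha]; pose proof (rk_le_exponent f i a Ha) as H.
  assert (L : (Some a : SuccOrd A) << None) by exact I; wo.
Qed.

Lemma rk_top_zero f (i : Fin k) : rk (Some (f, i)) = None -> f = om_zero A.
Proof.
  intros E; destruct (om_zero_dec f) as [|Hf]; auto; exfalso.
  exact (eq_ind _ (fun r => wlt (SuccOrd A) r None) (rk_some_lt_top f i Hf) _ E).
Qed.

(** The point omega^alpha * i has no exponent below alpha, so [None] is its only candidate. *)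
Lemma rk_multiple (i : Fin k) : proj1_sig i <> 0 -> rk (Some (om_zero A, i)) = None.
Proof.
  intros Hi; apply rk_unique; split; [exact I|].
  intros [a|] H; [|left; auto]; exfalso.
  destruct H as [H|[_ H]]; [exact (H eq_refl)|exact (Hi H)].
Qed.

(** The lower end of the neighbourhood is obtained by removing one copy of the last term of the
    normal form: omega^a if [a] is the least exponent, omega^alpha for multiples of it and for the
    top. Any point strictly between has a smaller exponent. *)
Lemma punctured_rank_lt x : nhd x (fun y => y <> x -> rk y << rk x).
Proof.
  destruct x as [[f i]|].
  - destruct (om_zero_dec f) as [->|Hf].
    + destruct i as [[|i] Hi].
      * exists None; split; [exact I|]; intros y _ Ly Ny; exfalso.
        destruct Ly as [|Ly]; auto.
        destruct y as [[g j]|]; [|exact Ly].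
        destruct Ly as [L|[_ L]]; simpl in L; [lia|exact (om_zero_least _ _ L)].
      * assert (Hi' : i < k) by lia.
        exists (Some (Some (om_zero A, exist _ i Hi') : SpOrd A k)); split.
        { left; simpl; lia. }
        intros y Hy Ly Ny; destruct Ly as [|Ly]; [contradiction|].
        rewrite rk_multiple by discriminate.
        destruct y as [[g j]|]; [|destruct Ly].
        apply rk_some_lt_top.
        destruct Ly as [L|[_ L]]; simpl in L; [|exfalso; exact (om_zero_least _ _ L)].
        destruct Hy as [L'|[_ L']]; simpl in L'; [lia|exact (om_zero_lt _ L')].
    + destruct (rk_rank (Some (f, i))) as [Hr Kr].
      destruct (rk (Some (f, i))) as [a|] eqn:Er.
      2:{ destruct Hf as [a Ha]; exfalso.
          destruct (Kr (Some a)) as [E|L]; [left; exact Ha|discriminate E|exact L]. }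
      assert (Ha : f$a <> 0).
      { destruct Hr as [|[E _]]; auto; simpl in E; rewrite E in Hf.
        destruct Hf as [b Hb]; exfalso; exact (Hb eq_refl). }
      assert (Hlow : forall b, b << a -> f$b = 0).
      { intros b Hb; apply NNPP; intros Nb.
        destruct (Kr (Some b)) as [E|L]; [left; exact Nb| |].
        - injection E as ->; exact (wlt_irrefl _ _ Hb).
        - assert (L' : a << b) by exact L; wo. }
      set (f' := om_update A f a (pred (f$a))).
      assert (Lf : om_lt A f' f).
      { exists a; simpl; rewrite update_eq; split; [lia|].
        intros b Hb; apply update_neq; intros ->; exact (wlt_irrefl _ _ Hb). }
      exists (Some (Some (f', i) : SpOrd A k)); split; [right; auto|].
      intros y Hy Ly Ny; destruct Ly as [|Ly]; [contradiction|].
      destruct y as [[g j]|]; [|destruct Ly].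
      assert (Hg : om_lt A f' g /\ om_lt A g f).
      { destruct Hy as [L|[E L]], Ly as [L'|[E' L']]; simpl in *; subst; try lia; auto. }
      (* [b] and [c] are the largest exponents where [g] differs from [f'] and from [f]. It turns
         out that [c = a] and [b << a], so [b] is an exponent of [g] below [a]. *)
      destruct Hg as [[b [Hb Kb]] [c [Hc Kc]]].
      assert (c = a) as ->.
      { destruct (wlt_total A c a) as [L|[|L]]; auto; exfalso.
        - rewrite (Hlow c L) in Hc; lia.
        - assert (f'$c = f$c)
            by (apply update_neq; intros ->; exact (wlt_irrefl _ _ L)).
          destruct (wlt_total A b c) as [L'|[->|L']].
          + rewrite <- (Kb c L') in Hc; lia.
          + lia.
          + assert (f'$b = f$b).
            { apply update_neq; intros ->; apply (wlt_irrefl A a); wo. }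
            rewrite (Kc b L') in Hb; lia. }
      assert (Ea : f'$a = pred (f$a)) by apply update_eq.
      assert (Lb : b << a).
      { destruct (wlt_total A b a) as [|[->|L']]; auto; exfalso; [lia|].
        assert (f'$b = f$b).
        { apply update_neq; intros ->; exact (wlt_irrefl _ _ L'). }
        rewrite (Kc b L') in Hb; lia. }
      pose proof (rk_le_exponent g j b) as H.
      assert (L' : (Some b : SuccOrd A) << Some a) by exact Lb.
      assert (H' : rk (Some (g, j)) <<= (Some b : SuccOrd A)) by (apply H; lia).
      change (rk (Some (g, j)) << rk (Some (f, i))); rewrite Er; wo.
  - assert (Hk : pred k < k) by lia.
    exists (Some (Some (om_zero A, exist _ (pred k) Hk) : SpOrd A k)); split; [exact I|].
    intros [[g j]|] Hy _ Ny; [|contradiction].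
    rewrite rk_top; apply rk_some_lt_top.
    destruct Hy as [L|[_ L]]; simpl in L; [|exact (om_zero_lt _ L)].
    destruct j as [j Hj]; simpl in L; lia.
Qed.

(** Adding omega^c to a lower bound of the neighbourhood gives a point of rank [c] that is still
    below [x]. *)
Lemma smaller_rank_nearby x r U : r << rk x -> nhd x U ->
  exists y, y <> x /\ U y /\ rk y = r.
Proof.
  intros Hr [a [Ha K]].
  destruct r as [c|]; [|destruct (rk x); destruct Hr].
  assert (exists g j, (Some (g, j) : SpOrd A k) << x /\
    forall y, (Some (g, j) : SpOrd A k) << y -> above a y) as [g [j [Hgj Hy]]].
  { destruct a as [[[g j]|]|].
    - exists g, j; auto.
    - destruct x; destruct Ha.
    (* Without a lower bound the origin serves: every [Some c] is a candidate for it, so its rank is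
       below that of [x]. *)
    - exists (om_zero A), fin0; split; [|intros; exact I].
      destruct (origin_least x) as [<-|]; auto; exfalso.
      assert (C : rank_cand origin (Some c)) by (right; auto).
      pose proof (proj2 (rk_rank origin) _ C); wo. }
  set (y := Some (bump A c g, j) : SpOrd A k).
  (* The rank of [x] is at most each of its exponents, so all of them exceed [c]. *)
  assert (Lc : forall f i b, x = Some (f, i) -> f$b <> 0 -> c << b).
  { intros f i b -> Hb; destruct (rk_le_exponent f i b Hb) as [E|L].
    - exact (eq_ind _ (wlt (SuccOrd A) (Some c)) Hr _ E).
    - exact (wlt_trans (SuccOrd A) (Some c) _ (Some b) Hr L). }
  assert (Lx : y << x).
  { destruct x as [[f i]|]; [|exact I].
    destruct Hgj as [L|[E [b [Hb Kb]]]]; simpl in *; [left; exact L|subst i; right].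
    simpl; split; auto.
    assert (c << b) by (apply (Lc f j); auto; lia).
    exists b; rewrite bump_above by auto; split; auto.
    intros d Hd; rewrite bump_above; auto; wo. }
  exists y; split; [|split].
  - intros E; rewrite E in Lx; exact (wlt_irrefl _ _ Lx).
  - apply K; [|right; auto]; apply Hy; right; simpl; split; auto.
    exists c; rewrite bump_at; split; [lia|].
    intros d Hd; rewrite bump_above; auto.
  - apply rk_bump.
Qed.

Lemma rk_cb_rank : cb_rank (SpOrd A k) (SuccOrd A) rk.
Proof.
  split; [|split].
  - exact punctured_rank_lt.
  - exact smaller_rank_nearby.
  - intros [c|].
    + exists (Some (bump A c (om_zero A), fin0)); apply rk_bump.
    + exists None; apply rk_top.
Qed.

Definition fin_of (n : nat) : Fin k :=
  match lt_dec n k with left H => exist _ n H | right _ => fin0 end.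

Lemma fin_of_val n : n < k -> proj1_sig (fin_of n) = n.
Proof. intros H; unfold fin_of; destruct (lt_dec n k); [auto|contradiction]. Qed.

(* When A = 0 the point 0 also has top rank. *)
Lemma top_rank_points (lo : nat) :
  (lo = 0 /\ (forall a : A, False)) \/ (lo = 1 /\ exists a : A, True) ->
  exists l : list (SpOrd A k), NoDup l /\ length l = S k - lo /\
    forall x, In x l <-> rk x = None.
Proof.
  intros Hlo; assert (Lo : lo <= k) by lia.
  exists (None :: map (fun n => Some (om_zero A, fin_of n)) (seq lo (k - lo))).
  split; [|split].
  - constructor.
    + intros H; apply in_map_iff in H; destruct H as [n [E _]]; discriminate.
    + apply NoDup_map_NoDup_ForallPairs; [|apply seq_NoDup].
      intros n n' Hn Hn' E; apply in_seq in Hn, Hn'.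
      injection E as E; apply (f_equal (@proj1_sig _ _)) in E.
      rewrite !fin_of_val in E by lia; exact E.
  - cbn [length]; rewrite length_map, length_seq; lia.
  - intros x; split.
    + intros [<-|H]; [exact rk_top|].
      apply in_map_iff in H; destruct H as [n [<- Hn]]; apply in_seq in Hn.
      destruct Hlo as [[-> Emp]|[-> _]].
      * destruct (rk _) as [a|]; auto; destruct (Emp a).
      * apply rk_multiple; rewrite fin_of_val; lia.
    + intros Hx; pose proof (proj2 (rk_rank x)) as Kr; rewrite Hx in Kr.
      destruct x as [[f i]|]; [right|left; auto].
      apply rk_top_zero in Hx; subst f.
      apply in_map_iff; exists (proj1_sig i); split.
      * f_equal; f_equal; apply sig_ext, fin_of_val; destruct i; auto.
      * apply in_seq; split; [|destruct i as [i Hi]; simpl; lia].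
        destruct Hlo as [[-> _]|[-> [a _]]]; [lia|].
        (* For nonempty [A] the origin has the candidate [Some a], so its rank is not [None]. *)
        destruct (Nat.eq_dec (proj1_sig i) 0) as [E|]; [|lia]; exfalso.
        destruct (Kr (Some a)) as [D|L]; [right; auto|discriminate D|exact L].
Qed.

End Rank.

(** The induced isomorphism of ranks preserves the top rank, so [h] matches the points of top rank.
    Their number is k + 1 - lo, with the same [lo] on both sides since [A] and [A'] are empty
    together. *)
Lemma homeomorphic_invariants (A A' : WOrd) (k k' : nat) : 0 < k -> 0 < k' ->
  homeomorphic (wlt (SpOrd A k)) (wlt (SpOrd A' k')) -> ord_iso A A' /\ k = k'.
Proof.
  intros Hk Hk' [h [g [gh [hg [Ch Cg]]]]].
  destruct (rank_exists A k) as [rk Hrk].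
  destruct (rank_exists A' k') as [rk' Hrk'].
  pose proof (rk_cb_rank A k Hk rk Hrk) as C.
  pose proof (rk_cb_rank A' k' Hk' rk' Hrk') as C'.
  destruct (cb_rank_iso (SpOrd A k) (SpOrd A' k') _ _ rk rk' h g C C' gh hg Ch Cg)
    as [th [th' [E [E' [L T]]]]].
  destruct (SuccOrd_iso A A' th th' E E' L) as [Top Iso].
  split; auto.
  assert (Hh : forall x, rk x = None <-> rk' (h x) = None).
  { intros x; rewrite <- T; split; intros K.
    - rewrite K; exact Top.
    - rewrite <- (E (rk x)), K, <- Top; apply E. }
  assert (exists lo,
    ((lo = 0 /\ forall a : A, False) \/ (lo = 1 /\ exists a : A, True)) /\
    ((lo = 0 /\ forall a : A', False) \/ (lo = 1 /\ exists a : A', True)))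
    as [lo [H1 H2]].
  { destruct Iso as [i [j _]].
    destruct (classic (exists a : A, True)) as [[a _]|N].
    - exists 1; split; right; split; auto; [exists a|exists (i a)]; auto.
    - exists 0; split; left; split; auto; intros a; apply N; [exists a|exists (j a)]; auto. }
  destruct (top_rank_points A k Hk rk Hrk lo H1) as [l [Nl [Ll Hl]]].
  destruct (top_rank_points A' k' Hk' rk' Hrk' lo H2) as [l' [Nl' [Ll' Hl']]].
  assert (P : length (map h l) <= length l').
  { apply NoDup_incl_length.
    - apply NoDup_map_NoDup_ForallPairs; auto.
      intros x y _ _ K; rewrite <- (gh x), <- (gh y), K; auto.
    - intros y Hy; apply in_map_iff in Hy; destruct Hy as [x [<- Hx]].
      apply Hl', Hh, Hl; auto. }
  assert (P' : length (map g l') <= length l).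
  { apply NoDup_incl_length.
    - apply NoDup_map_NoDup_ForallPairs; auto.
      intros x y _ _ K; rewrite <- (hg x), <- (hg y), K; auto.
    - intros y Hy; apply in_map_iff in Hy; destruct Hy as [x [<- Hx]].
      apply Hl, Hh; rewrite hg; apply Hl'; auto. }
  rewrite length_map in P, P'; lia.
Qed.

Theorem theorem29 :
  (forall (A A' : WOrd) (k k' : nat), 0 < k -> 0 < k' ->
     top_grp_iso (spak_lt A k) (spak_lt A' k') ->
     ord_iso A A' /\ k = k') /\
  (forall B B' : WOrd,
     top_grp_iso (succ_lt (wlt B)) (succ_lt (wlt B')) ->
     homeomorphic (succ_lt (wlt B)) (succ_lt (wlt B'))).
Proof.
  split.
  (* [spak_lt A k] and the order of [SpOrd A k] are convertible. *)
  - intros A A' k k' Hk Hk' I; apply homeomorphic_invariants; auto.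
    apply (reconstruction (SpOrd A k) (SpOrd A' k') None None); auto;
      intros; apply SuccOrd_max.
  - intros B B' I.
    apply (reconstruction (SuccOrd B) (SuccOrd B') None None); auto;
      intros; apply SuccOrd_max.
Qed.
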